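(* Let $N\ge1$ and let $X=\{X(t), t\in\mathbb{R}^N\}$ be a centered, unit-variance, smooth isotropic Gaussian random field on $\mathbb{R}^N$ with $\mathbb{E}\{X(t)X(s)\}=\rho(\|t-s\|^2)$ and $\rho'\rho''\ne0$. Let $\widetilde{M}$ and $M$ be $N\times N$ random matrices that are $\mathrm{GOI}(1/2)$ and $\mathrm{GOI}((1-\kappa^2)/2)$ respectively. Then for every $t\in\mathbb{R}^N$ and $x\in\mathbb{R}$: (i) the distribution of $\nabla^2X(t)$ is the same as that of $\sqrt{8\rho''}\,\widetilde{M}$; (ii) the conditional distribution of $\nabla^2X(t)$ given $X(t)=x$ is the same as the distribution of $\sqrt{8\rho''}\,\big[M-\big(\kappa x/\sqrt{2}\big)I_N\big]$.
   Context: Smoothness: $X$ has almost surely $C^2$ sample paths and there are finite $K,\alpha>0$ such that for all $i,j$, $\mathbb{E}[(X_{ij}(t)-X_{ij}(s))^2]\le K\,|\ln\|t-s\||^{-(1+\alpha)}$ for all $\|t-s\|$ small enough, where $X_{ij}=\partial^2X/\partial t_i\partial t_j$ (this holds in particular if $X$ is $C^3$). $\nabla^2X(t)=(X_{ij}(t))_{1\le i,j\le N}$ is the Hessian. Parameters: $\rho:[0,\infty)\to\mathbb{R}$; $\rho'=\rho'(0)$, $\rho''=\rho''(0)$ (then $\rho'<0<\rho''$), $\kappa=-\rho'/\sqrt{\rho''}$. An $N\times N$ random matrix $M=(M_{ij})$ is $\mathrm{GOI}(c)$ (Gaussian Orthogonally Invariant with covariance parameter $c\in\mathbb{R}$) if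 it is symmetric and its entries are (jointly) centered Gaussian with $\mathbb{E}[M_{ij}M_{kl}]=\frac12(\delta_{ik}\delta_{jl}+\delta_{il}\delta_{jk})+c\,\delta_{ij}\delta_{kl}$, $\delta$ being the Kronecker delta. $I_N$ is the identity matrix. *)

(* Defs.v *)
From HB Require Import structures.
From mathcomp Require Import all_boot all_order all_algebra.
From mathcomp Require Import all_classical all_reals all_analysis.

Set Implicit Arguments.
Unset Strict Implicit.
Unset Printing Implicit Defensive.

Import Order.TTheory GRing.Theory Num.Theory.
Import numFieldNormedType.Exports.

Local Open Scope classical_set_scope.
Local Open Scope ring_scope.

Section calculus.
Variable R : realType.

(* Derivative of a function defined on the half-line [0, +oo[, which is
   one-sided at 0: the values of f at negative arguments are never used. *)
Definition deriv_halfline (f : R -> R) (x : R) : R :=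
  lim ((fun y => (f y - f x) / (y - x)) @ within [set y | 0 <= y] (x^')).

Variable N : nat.

(* The library norm on 'rV[R]_N is the sup norm. *)
Definition enorm (t : 'rV[R]_N) : R := Num.sqrt (\sum_(i < N) t 0 i ^+ 2).

Definition partial (i : 'I_N) (f : 'rV[R]_N -> R) : 'rV[R]_N -> R :=
  'D_(delta_mx 0 i) f.

Definition C1 (f : 'rV[R]_N -> R) : Prop :=
  continuous f /\
  forall i, (forall t, derivable f t (delta_mx 0 i)) /\
            continuous (partial i f).

Definition C2 (f : 'rV[R]_N -> R) : Prop :=
  C1 f /\ forall i, C1 (partial i f).

Definition hessian (f : 'rV[R]_N -> R) (t : 'rV[R]_N) : 'M[R]_N :=
  \matrix_(i, j) partial i (partial j f) t.

End calculus.

Definition borel_mx (R : realType) (N : nat) :=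
  g_sigma_algebraType (@open 'M[R]_N).

HB.instance Definition _ (R : realType) (N : nat) :=
  Measurable.copy (borel_mx R N) (g_sigma_algebraType (@open 'M[R]_N)).

Section probability.
Context d (T : measurableType d) (R : realType) (P : probability T R).

(* Univariate normal law, point masses included. They are listed apart because
   the library's normal_prob m 0 is not the point mass at m. *)
Definition gaussian_rv (Y : T -> R) : Prop :=
  measurable_fun setT Y /\ exists m : R,
    (forall A : set R, measurable A -> P (Y @^-1` A) = \d_m A) \/
    (exists2 s : R, s != 0 &
      forall A : set R, measurable A -> P (Y @^-1` A) = normal_prob m s A).

Definition jointly_gaussian (I : Type) (Y : I -> T -> R) : Prop :=
  forall (n : nat) (u : 'I_n -> I) (a : 'I_n -> R),
    gaussian_rv (fun w => \sum_(k < n) a k * Y (u k) w).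

Definition smooth_field (N : nat) (X : 'rV[R]_N -> T -> R) : Prop :=
  {ae P, forall w, C2 (X^~ w)} /\
  exists K alpha : R, [/\ 0 < K, 0 < alpha &
    exists2 delta : R, 0 < delta &
      forall (i j : 'I_N) (t s : 'rV[R]_N), 0 < enorm (t - s) < delta ->
        ('E_P[fun w => ((hessian (X^~ w) t i j - hessian (X^~ w) s i j) ^+ 2)%R]
         <= (K * `|ln (enorm (t - s))| `^ (- (1 + alpha)))%:E)%E].

Definition GOI (N : nat) (c : R) (M : {RV P >-> borel_mx R N}) : Prop :=
  let entry (i j : 'I_N) (w : T) : R := (M w : 'M[R]_N) i j in
  [/\ {ae P, forall w, (M w : 'M[R]_N) = (M w : 'M[R]_N)^T},
      jointly_gaussian (fun ij : 'I_N * 'I_N => entry ij.1 ij.2),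
      forall i j, ('E_P[entry i j] = 0)%E &
      forall i j k l, ('E_P[fun w => (entry i j w * entry k l w)%R] =
        (2^-1 * ((i == k)%:R * (j == l)%:R + (i == l)%:R * (j == k)%:R)
         + c * (i == j)%:R * (k == l)%:R)%:E)%E].

(* Y is a random element defined up to null sets: it need only agree almost
   surely with a measurable map (the Hessian of a field whose paths are C2 only
   almost surely is arbitrary on a null event). The law of Y is the law of any
   such Y'. *)
Definition version d' (S : measurableType d') (Y : T -> S)
    (Y' : {RV P >-> S}) : Prop :=
  {ae P, forall w, Y w = Y' w}.

(* k is the conditional law of the random matrix Y given the real random
   variable Z: it disintegrates the law of (Z, Y) over that of Z. This
   determines k x only for almost all x; weak continuity in x selects a version
   that is unique at every x in the support of the law of Z. *)
Definition conditional_law (N : nat) (Y : T -> borel_mx R N)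
    (Z : {RV P >-> R}) (k : R.-pker R ~> borel_mx R N) : Prop :=
  (exists2 Y' : {RV P >-> borel_mx R N}, version Y Y' &
    forall (B : set R) (A : set (borel_mx R N)), measurable B -> measurable A ->
      P (Z @^-1` B `&` Y' @^-1` A)
      = (\int[distribution P Z]_(x in B) k x A)%E) /\
  (forall f : 'M[R]_N -> R, continuous f ->
    (exists C : R, forall y, `|f y| <= C) ->
    continuous (fun x => \int[k x]_(y in [set: borel_mx R N]) f y)).

End probability.

Definition same_law d1 (T1 : measurableType d1) d2 (T2 : measurableType d2)
    d' (S : measurableType d') (R : realType)
    (P1 : probability T1 R) (P2 : probability T2 R)
    (Y1 : T1 -> S) (Y2 : T2 -> S) : Prop :=
  exists (Y1' : {RV P1 >-> S}) (Y2' : {RV P2 >-> S}),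
    [/\ version Y1 Y1', version Y2 Y2' &
        forall A : set S, measurable A ->
          distribution P1 Y1' A = distribution P2 Y2' A].

(* Main.v *)
Require Import Defs.
From HB Require Import structures.
From mathcomp Require Import all_boot all_order all_algebra.
From mathcomp Require Import all_classical all_reals all_analysis.
From mathcomp Require Import measurable_realfun ring lra.

Set Implicit Arguments.
Unset Strict Implicit.
Unset Printing Implicit Defensive.

Import Order.TTheory GRing.Theory Num.Theory.
Import numFieldNormedType.Exports.

Local Open Scope classical_set_scope.
Local Open Scope ring_scope.

(* The second differences of X at t at scale h are Gaussian; their covariances
   with each other and with X(t) are finite combinations of values of rho at
   multiples of h^2, and the expansion of rho at 0 to second order gives their
   limits as h -> 0. Almost surely the differences tend to the Hessian, so its
   entries and X(t) have the sine transform
   E sin(L + th) = sin th * exp(- V / 2) of a centered Gaussian family with the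
   limiting covariances. For a Gaussian variable this transform follows from
   Stein's identity, and sine transforms determine laws (Cramer-Wold): products
   of waves are sums of waves, and the signs of the coordinates, hence
   indicators of half-spaces, are bounded limits of polynomials in waves.
   (i) compares the transform of the Hessian with that of sqrt(8 rho'') Mt.
   (ii) compares that of (X(t), Hessian) with that of
   (Z, sqrt(8 rho'') (M - (kappa Z / sqrt 2) I)), where Z has the law of X(t) and is
   independent of M. *)

(** Joint Gaussianity and covariances are given for values of X only, and the Hessian exists only
    almost surely; hence the detour through second differences. As the sine is bounded, almost sure
    convergence is enough to pass to the limit in E sin(L + th), while the limit of the variances is
    computed separately from rho. The free phase th lets a real sine carry both parts of the
    characteristic function. The Gaussian vectors are singular in general (a symmetric matrix
    repeats entries), so conditioning is not a quotient of densities: (ii) is an identity of joint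
    laws. It rests on completing a square. With r1 = rho', r2 = rho'' and tr the sum of the a_ii,
    the variance of a0 X(t) + sum a_ij X_ij(t) is (a0 + 2 r1 tr)^2 plus the variance of sqrt(8 r2)
    sum a_ij M_ij, M being GOI((1 - kappa^2) / 2). The first term is the regression on X(t); its
    coefficient 2 r1 equals - sqrt(8 r2) kappa / sqrt 2, the origin of the shift by kappa x / sqrt
    2. The sign of rho'' is derived: the limiting variance of a diagonal entry is 12 rho''. *)

Section bounded_convergence.
Context d (T : measurableType d) (R : realType).

Lemma integrable_bounded (mu : {finite_measure set T -> \bar R}) (f : T -> R)
    (C : R) :
  measurable_fun setT f -> (forall x, `|f x| <= C) ->
  mu.-integrable setT (EFin \o f).
Proof.
move=> mf fC; apply: measurable_bounded_integrable => //.
  exact: fin_num_fun_lty (fin_num_measure mu).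
by exists C; split => [|M CM x _ /=]; rewrite ?num_real// (le_trans (fC x))// ltW.
Qed.

(** Convergence is asked only almost everywhere because the paths are C2 only almost surely. *)
Lemma cvg_Rintegral_ae_bounded (mu : {finite_measure set T -> \bar R})
    (f_ : nat -> T -> R) (f : T -> R) (C : R) :
  (forall n, measurable_fun setT (f_ n)) -> measurable_fun setT f ->
  (forall n x, `|f_ n x| <= C) ->
  {ae mu, forall x, f_ n x @[n --> \oo] --> f x} ->
  (\int[mu]_x f_ n x) @[n --> \oo] --> \int[mu]_x f x.
Proof.
move=> mf_ mf fC f_f.
have [|||||intf _ +] := @dominated_convergence _ _ _ mu _ measurableT
    (fun n => EFin \o f_ n) (EFin \o f) (cst C%:E) _ _ _ _ _.
- by move=> n; exact/measurable_EFinP.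
- exact/measurable_EFinP.
- by apply: filterS f_f => x + _; apply: cvg_EFin; near=> n.
- exact: (@integrable_bounded _ (cst C) `|C|).
- by apply: aeW => x n _ /=; rewrite lee_fin.
move=> h; apply: fine_cvg.
rewrite fineK//; exact: integrable_fin_num.
Unshelve. all: end_near. Qed.

Lemma integrable_EFinZl (mu : {measure set T -> \bar R}) (k : R) (f : T -> R) :
  mu.-integrable setT (EFin \o f) ->
  mu.-integrable setT (EFin \o (fun x => k * f x)).
Proof.
move=> intf; rewrite (_ : _ \o _ = fun x => (k%:E * (f x)%:E)%E).
  exact: integrableZl.
by apply/funext => x /=; rewrite EFinM.
Qed.

End bounded_convergence.

(** * Integrals of derivatives over the whole line *)

Section integral_derivative.
Context {R : realType}.
Notation mu := lebesgue_measure.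

(** Fundamental theorem of calculus on growing intervals, then dominated convergence with bound
    |f|. *)
Lemma Rintegral_derivative_eq0 (F f : R -> R) :
  (forall x : R, is_derive x (1 : R) F (f x)) -> continuous f ->
  mu.-integrable setT (EFin \o f) ->
  F n%:R @[n --> \oo] --> (0 : R) -> F (- n%:R) @[n --> \oo] --> (0 : R) ->
  \int[mu]_x f x = 0.
Proof.
move=> dF cf intf Fy FNy.
have mf : measurable_fun setT f by exact: continuous_measurable_fun.
(* [n.+1] rather than [n] keeps the interval nondegenerate. *)
pose fn n := f \_ `[- n.+1%:R : R, n.+1%:R].
have fnE n : (\int[mu]_x (fn n x)%:E)%E = (F n.+1%:R - F (- n.+1%:R))%:E.
  have -> : (fun x => (fn n x)%:E) = (EFin \o f) \_ `[- n.+1%:R : R, n.+1%:R].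
    by rewrite restrict_EFin.
  rewrite -integral_mkcond (@continuous_FTC2 _ f F)//.
  - by rewrite (@lt_trans _ _ 0)// ?oppr_lt0.
  - exact: continuous_subspaceT.
  - have cF x : {for x, continuous F}.
      by apply/differentiable_continuous/derivable1_diffP; have [] := dF x.
    split => [x _||]; first by have [] := dF x.
    + exact/cvg_at_right_filter/cF.
    + exact/cvg_at_left_filter/cF.
  - by move=> x _; rewrite derive1E; exact: derive_val.
have [|||||_ _ +] := @dominated_convergence _ _ _ mu _ measurableT
    (fun n => EFin \o fn n) (EFin \o f) (fun x => `|(f x)%:E|%E) _ _ _ _ _.
- move=> n; apply/measurable_EFinP/(measurable_restrictT f) => //.
  exact/measurable_funTS.
- exact/measurable_EFinP.
- apply: aeW => x _; apply: cvg_EFin; first by near=> n.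
  apply: (cvg_trans _ (@cvg_cst _ (f x) _ \oo _)); apply: near_eq_cvg.
  near=> n; rewrite /= /fn patchE ifT// inE/= in_itv/=.
  rewrite -ler_norml (@le_trans _ _ n%:R) ?ler_nat//.
  by near: n; exact: nbhs_infty_ger.
- exact: integrable_abse.
- apply: aeW => x n _; rewrite /= lee_fin /fn patchE.
  by case: ifP => //; rewrite normr0.
move=> h; rewrite /Rintegral.
suff -> : (\int[mu]_x (f x)%:E = 0)%E by [].
apply/(cvg_unique _ h) => //=.
under eq_fun do rewrite fnE.
apply: cvg_EFin; first by near=> n.
rewrite -[X in _ --> X](subrr 0); apply: cvgB.
- by move: Fy; rewrite -(cvg_shiftS (fun n => F n%:R)).
- by move: FNy; rewrite -(cvg_shiftS (fun n => F (- n%:R))).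
Unshelve. all: end_near. Qed.

End integral_derivative.

(** * Sine transform of the normal law *)

Section normal_integrals.
Context {R : realType}.
Variables m s : R.
Hypothesis s0 : s != 0.
Notation mu := lebesgue_measure.
Notation p := (normal_pdf m s).

Let s2_gt0 : 0 < s ^+ 2. Proof. by rewrite exprn_even_gt0. Qed.

Let pE x : p x = normal_peak s * expR (- (x - m) ^+ 2 / (s ^+ 2 *+ 2)).
Proof. by rewrite normal_pdfE. Qed.

Lemma is_derive_normal_pdf (x : R) :
  is_derive x (1 : R) p (- ((x - m) / s ^+ 2) * p x).
Proof.
rewrite normal_pdfE// /normal_fun.
apply: is_derive_eq.
rewrite /GRing.scale /=.
by field.
Qed.

(** Half of the exponent absorbs the quadratic factor, as u exp(- u) <= 1 for u = (x - m)^2 / (4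
    s^2); the other half is a Gaussian of deviation sqrt 2 s. *)
Lemma sqrM_normal_pdf_le (x : R) :
  (x - m) ^+ 2 * p x <= 4 * s ^+ 2 * normal_peak s * normal_fun m (Num.sqrt 2 * s) x.
Proof.
rewrite pE /normal_fun exprMn sqr_sqrtr//.
set y := (x - m) ^+ 2.
have e1 : expR (- y / (s ^+ 2 *+ 2)) =
    expR (- y / ((2 * s ^+ 2) *+ 2)) * expR (- (y / (4 * s ^+ 2))).
  by rewrite -expRD; congr expR; field.
have e2 : y / (4 * s ^+ 2) * expR (- (y / (4 * s ^+ 2))) <= 1.
  rewrite expRN ler_pdivrMr ?expR_gt0// mul1r.
  by rewrite (le_trans _ (expR_ge1Dx _))// lerDr.
rewrite e1.
have -> : y * (normal_peak s * (expR (- y / (2 * s ^+ 2 *+ 2)) * expR (- (y / (4 * s ^+ 2))))) =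
  4 * s ^+ 2 * normal_peak s * expR (- y / (2 * s ^+ 2 *+ 2)) * (y / (4 * s ^+ 2) * expR (- (y / (4 * s ^+ 2)))).
  by field.
rewrite ler_piMr// mulr_ge0 ?expR_ge0// mulr_ge0 ?normal_peak_ge0//.
by rewrite mulr_ge0// ltW.
Qed.

(** The dominating function combines two normal densities, of deviations s and sqrt 2 s, so
    quadratic growth is controlled before any moment is computed. *)
Lemma integrable_normal_pdfM (g : R -> R) (A : R) : measurable_fun setT g ->
  (forall x, `|g x| <= A * (1 + (x - m) ^+ 2)) ->
  mu.-integrable setT (fun x => (g x * p x)%:E).
Proof.
move=> mg gA.
have A0 : 0 <= A.
  have := le_trans (normr_ge0 _) (gA m).
  by rewrite subrr expr0n addr0 mulr1.
have r0 : Num.sqrt 2 * s != 0 by rewrite mulf_neq0// gt_eqF// sqrtr_gt0.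
pose C := 4 * s ^+ 2 * normal_peak s / normal_peak (Num.sqrt 2 * s).
have ig : mu.-integrable setT
    (fun x => (A * (p x + C * normal_pdf m (Num.sqrt 2 * s) x))%:E).
  under eq_fun do rewrite EFinM EFinD EFinM.
  apply: integrableZl => //; apply: integrableD => //.
    exact: integrable_normal_pdf.
  apply: integrableZl => //; exact: integrable_normal_pdf.
apply: le_integrable ig => //.
  apply/measurable_EFinP/measurable_funM => //.
  exact: measurable_normal_pdf.
move=> x _; rewrite lee_fin normrM (ger0_norm (normal_pdf_ge0 _ _ _)).
rewrite (le_trans _ (ler_norm _))//.
rewrite (@le_trans _ _ (A * (1 + (x - m) ^+ 2) * p x))//.
  by rewrite ler_wpM2r// normal_pdf_ge0.
rewrite -mulrA ler_wpM2l// mulrDl mul1r lerD2l.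
rewrite (le_trans (sqrM_normal_pdf_le x))// /C (normal_pdfE _ r0).
by rewrite [leRHS]mulrA divfK// gt_eqF// normal_peak_gt0.
Qed.

(** Since (x - m)^2 p(x) is bounded, a factor of linear growth leaves O(1 / |x - m|). The form with
    a sequence serves both ends of the line. *)
Lemma normal_pdfM_cvg0 (g : R -> R) (A : R) (u : nat -> R) :
  (forall x, `|g x| <= A * (1 + `|x - m|)) ->
  `|u n| @[n --> \oo] --> +oo ->
  g (u n) * p (u n) @[n --> \oo] --> (0 : R).
Proof.
move=> gA uy.
have A0 : 0 <= A.
  have := le_trans (normr_ge0 _) (gA m).
  by rewrite subrr normr0 addr0 mulr1.
pose K := 4 * s ^+ 2 * normal_peak s.
have K0 : 0 <= K by rewrite mulr_ge0 ?normal_peak_ge0// mulr_ge0// ltW.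
have pK x : (x - m) ^+ 2 * p x <= K.
  rewrite (le_trans (sqrM_normal_pdf_le x))// ler_piMr//.
  rewrite /normal_fun -expR0 ler_expR mulNr oppr_le0.
  by rewrite divr_ge0 ?mulrn_wge0 ?sqr_ge0.
have um : `|u n| - `|m| @[n --> \oo] --> +oo.
  apply/cvgryPge => B; near=> n; rewrite lerBrDr.
  by near: n; move/cvgryPge : uy; exact.
apply: norm_cvg0.
(* With y = |u n - m| >= 1, A (1 + y) p y <= 2 A y^2 p <= 2 A K, and y >= |u n| - |m|. *)
apply: (@squeeze_cvgr _ _ _ _ (cst 0) (fun n => 2 * A * K / (`|u n| - `|m|))).
- near=> n.
  rewrite /= normr_ge0/= normrM (ger0_norm (normal_pdf_ge0 _ _ _)).
  have un1 : 1 <= `|u n| - `|m| by near: n; move/cvgryPge : um; exact.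
  have yn : `|u n| - `|m| <= `|u n - m| by exact: lerB_dist.
  have y1 := le_trans un1 yn.
  rewrite ler_pdivlMr ?(lt_le_trans _ un1)//.
  have y0 : 0 < `|u n - m| by exact: lt_le_trans y1.
  have := pK (u n); rewrite -real_normK ?num_real// => pKn.
  rewrite (@le_trans _ _ (A * (1 + `|u n - m|) * p (u n) * `|u n - m|))//.
    rewrite ler_pM ?mulr_ge0 ?normal_pdf_ge0//; last 2 first.
    by rewrite (le_trans _ un1).
    by rewrite ler_wpM2r// normal_pdf_ge0.
  rewrite (@le_trans _ _ (A * (2 * (`|u n - m| ^+ 2 * p (u n)))))//; last first.
    by rewrite -[leRHS]mulrA [leRHS]mulrCA ler_wpM2l// ler_wpM2l.
  move: (normal_pdf_ge0 m s (u n)) y1; move: `|u n - m| (p (u n)) => y q q0 y1.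
  have h : 0 <= (y - 1) * y * q by rewrite !mulr_ge0 ?subr_ge0// (le_trans _ y1).
  rewrite -!(mulrA A) ler_wpM2l//; nra.
- exact: cvg_cst.
- rewrite -[X in _ --> X](mulr0 (2 * A * K)); apply: cvgMr.
  apply: (gtr0_cvgV0 _).2 (um).
  near=> n; rewrite (@lt_le_trans _ _ 1)//.
  by near: n; move/cvgryPge : um; exact.
Unshelve. all: end_near. Qed.

Lemma continuous_normal_pdfM (g : R -> R) :
  continuous g -> continuous (fun x => g x * p x).
Proof.
by move=> cg x; apply: cvgM; [exact: cg|exact: continuous_normal_pdf].
Qed.

(* Stein's identity: the integrand is the derivative of [h * p]. *)
Lemma normal_stein (h h' : R -> R) (A : R) :
  (forall x : R, is_derive x (1 : R) h (h' x)) -> continuous h' ->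
  (forall x, `|h x| <= A * (1 + `|x - m|)) -> (forall x, `|h' x| <= A) ->
  \int[mu]_x ((h' x - h x * ((x - m) / s ^+ 2)) * p x) = 0.
Proof.
move=> dh ch' hA h'A.
have ch : continuous h.
  move=> x; apply/differentiable_continuous/derivable1_diffP.
  by have [] := dh x.
have A0 : 0 <= A by rewrite (le_trans _ (h'A 0)).
have cg : continuous (fun x => h' x - h x * ((x - m) / s ^+ 2)).
  move=> x; apply: cvgB; first exact: ch'.
  apply: cvgM; first exact: ch.
  by apply: cvgM; [apply: cvgB; [exact: cvg_id|exact: cvg_cst]|exact: cvg_cst].
apply: (@Rintegral_derivative_eq0 _ (fun x => h x * p x)).
- move=> x; have := dh x; have := is_derive_normal_pdf x => dp dhx.
  apply: is_derive_eq; rewrite /GRing.scale /=.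
  by ring.
- exact: continuous_normal_pdfM.
- apply: (@integrable_normal_pdfM _ (A + 2 * A / s ^+ 2)).
    exact: continuous_measurable_fun.
  move=> x; rewrite (le_trans (ler_normB _ _))// [leRHS]mulrDl lerD//.
    by rewrite (le_trans (h'A x))// ler_peMr// lerDl sqr_ge0.
  have sV0 : 0 <= (s ^+ 2)^-1 by rewrite invr_ge0 ltW.
  rewrite !normrM (ger0_norm sV0).
  rewrite [leRHS]mulrAC mulrA ler_wpM2r//.
  rewrite -(mulrA 2) (mulrCA 2).
  rewrite (le_trans (ler_wpM2r _ (hA x)))// -!mulrA ler_wpM2l//.
  rewrite -[in leRHS](@real_normK _ (x - m)) ?num_real//.
  have := normr_ge0 (x - m); move: `|x - m| => y y0.
  have := sqr_ge0 (1 - y); nra.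
- by apply: normal_pdfM_cvg0 hA _; under eq_fun do rewrite ger0_norm//; exact: cvgr_idn.
- apply: normal_pdfM_cvg0 hA _.
  by under eq_fun do rewrite normrN ger0_norm//; exact: cvgr_idn.
Qed.

End normal_integrals.

Section normal_law.
Context {R : realType}.
Notation mu := lebesgue_measure.
Implicit Types m s : R.

(** The Radon-Nikodym derivative agrees almost everywhere with the density because both have the
    same integral over every measurable set. *)
Lemma Rintegral_normal_prob m s (f : R -> R) : s != 0 ->
  (normal_prob m s).-integrable setT (EFin \o f) ->
  \int[normal_prob m s]_x f x = \int[mu]_x (f x * normal_pdf m s x).
Proof.
move=> s0 intf; rewrite /Rintegral; congr fine.
have numu := @normal_prob_dominates _ m s.
have mf : measurable_fun setT (EFin \o f) by exact: measurable_int intf.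
rewrite -(Radon_Nikodym_change_of_variables numu)//=.
apply: ae_eq_integral => //.
- by apply: emeasurable_funM => //; apply: (measurable_int mu).
- apply/measurable_EFinP/measurable_funM; first exact/measurable_EFinP.
  exact: measurable_normal_pdf.
- suff rn : ae_eq mu setT (Radon_Nikodym (charge_of_finite_measure (normal_prob m s)) mu)
      (EFin \o normal_pdf m s).
    by apply: filterS rn => x + _ => /(_ I) /= ->; rewrite EFinM.
  rewrite Radon_NikodymE//=.
  case: cid => /= h [h1 h2 h3].
  apply: integral_ae_eq => //=.
    by apply/measurable_EFinP; exact: measurable_normal_pdf.
  by move=> E _ mE; rewrite -h3.
Qed.

Lemma Rintegral_normal_pdf m s : \int[mu]_x normal_pdf m s x = 1.
Proof. by rewrite /Rintegral integral_normal_pdf. Qed.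

(** Stein's identity for h = 1. *)
Lemma Rintegral_normal_mean m s : s != 0 ->
  \int[mu]_x (x * normal_pdf m s x) = m.
Proof.
move=> s0.
have s20 : s ^+ 2 != 0 by rewrite expf_neq0.
have i1 : mu.-integrable setT (EFin \o (fun x : R => (x - m) * normal_pdf m s x)).
  apply: (@integrable_normal_pdfM _ m s s0 (fun x => x - m) 1) => [|x].
    exact: measurable_funB.
  rewrite mul1r -[in leRHS](@real_normK _ (x - m)) ?num_real//.
  move: (normr_ge0 (x - m)); move: `|x - m| => y y0.
  by have := sqr_ge0 (1 - y); nra.
have h : \int[mu]_x ((0 - 1 * ((x - m) / s ^+ 2)) * normal_pdf m s x) = 0.
  apply: (@normal_stein _ m s s0 (cst 1) (cst 0) 1) => //.
  - by move=> x; exact: cst_continuous.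
  - by move=> x; rewrite normr1 mul1r lerDl.
  - by move=> x; rewrite normr0.
have {h} h : \int[mu]_x ((x - m) * normal_pdf m s x) = 0.
  transitivity (\int[mu]_x (- s ^+ 2 *
      ((0 - 1 * ((x - m) / s ^+ 2)) * normal_pdf m s x))).
    by apply: eq_Rintegral => x _; field.
  rewrite RintegralZl//; first by rewrite h mulr0.
  rewrite (_ : (fun x => _) = fun x => (- (s ^+ 2)^-1) * ((x - m) * normal_pdf m s x)).
    exact: integrable_EFinZl.
  by apply/funext => x; field.
transitivity (\int[mu]_x ((x - m) * normal_pdf m s x + m * normal_pdf m s x)).
  by apply: eq_Rintegral => x _; ring.
have i2 := @integrable_normal_pdf _ m s.
rewrite RintegralD//; last exact: integrable_EFinZl.
by rewrite h RintegralZl// add0r Rintegral_normal_pdf mulr1.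
Qed.

(** Stein's identity for h(x) = x - m. *)
Lemma Rintegral_normal_variance m s : s != 0 ->
  \int[mu]_x ((x - m) ^+ 2 * normal_pdf m s x) = s ^+ 2.
Proof.
move=> s0.
have s20 : s ^+ 2 != 0 by rewrite expf_neq0.
have i1 : mu.-integrable setT (EFin \o (fun x : R => (x - m) ^+ 2 * normal_pdf m s x)).
  apply: (@integrable_normal_pdfM _ m s s0 (fun x => (x - m) ^+ 2) 1) => //.
    by apply: measurable_funX; exact: measurable_funB.
  by move=> x; rewrite mul1r ger0_norm ?sqr_ge0// lerDr.
have i2 := @integrable_normal_pdf _ m s.
have h : \int[mu]_x ((1 - (x - m) * ((x - m) / s ^+ 2)) * normal_pdf m s x) = 0.
  apply: (@normal_stein _ m s s0 (fun x => x - m) (cst 1) 1) => //.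
  - by move=> x; apply: is_derive_eq; rewrite subr0.
  - by move=> x; exact: cst_continuous.
  - by move=> x; rewrite mul1r lerDr.
  - by move=> x; rewrite normr1.
have : \int[mu]_x (normal_pdf m s x - (s ^+ 2)^-1 * ((x - m) ^+ 2 * normal_pdf m s x)) = 0.
  by rewrite -h; apply: eq_Rintegral => x _; field.
rewrite RintegralB//; last exact: integrable_EFinZl.
rewrite RintegralZl// Rintegral_normal_pdf => /eqP.
rewrite subr_eq0 eq_sym => /eqP e.
by rewrite -[LHS](mulVKf s20) e mulr1.
Qed.

(** Let G(t) be the integral of sin(t x + th) against the density. Differentiation under the
    integral and Stein's identity for h(x) = cos(t x + th) give G' = - s^2 t G, so G(t) exp(s^2 t^2
    / 2) is constant; compare t = 1 with t = 0. *)
Lemma Rintegral_normal_sin s (th : R) : s != 0 ->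
  \int[mu]_x (sin (x + th) * normal_pdf 0 s x) = sin th * expR (- s ^+ 2 / 2).
Proof.
move=> s0.
have s20 : s ^+ 2 != 0 by rewrite expf_neq0.
pose f t x := sin (t * x + th) * normal_pdf 0 s x.
pose G t := \int[mu]_x f t x.
have csc t : continuous (fun x : R => t * x + th).
  move=> x; apply: cvgD; last exact: cvg_cst.
  by apply: cvgM; [exact: cvg_cst|exact: cvg_id].
have csin t : continuous (fun x : R => sin (t * x + th)).
  move=> x; apply: continuous_comp; first exact: csc.
  exact: continuous_sin.
have ccos t : continuous (fun x : R => cos (t * x + th)).
  move=> x; apply: continuous_comp; first exact: csc.
  exact: continuous_cos.
have intf t : mu.-integrable setT (EFin \o f t).
  apply: (@integrable_normal_pdfM _ 0 s s0 _ 1) => [|x].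
    exact: continuous_measurable_fun.
  by rewrite mul1r (le_trans (sin_max _))// lerDl sqr_ge0.
have pf t x : is_derive t (1 : R) (f ^~ x) (x * cos (t * x + th) * normal_pdf 0 s x).
  apply: is_derive_eq.
  by rewrite /GRing.scale /=; ring.
have intxc t : mu.-integrable setT
    (EFin \o (fun x : R => x * cos (t * x + th) * normal_pdf 0 s x)).
  apply: (@integrable_normal_pdfM _ 0 s s0 (fun x => x * cos (t * x + th)) 1) => [|x].
    by apply: measurable_funM => //; exact: continuous_measurable_fun.
  rewrite mul1r subr0 normrM.
  rewrite (@le_trans _ _ (`|x| * 1))// ?ler_wpM2l ?cos_max//.
  rewrite -[in leRHS](@real_normK _ x) ?num_real//.
  move: (normr_ge0 x); move: `|x| => y y0.
  by have := sqr_ge0 (1 - y); nra.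
have G'E t : \int[mu]_x (x * cos (t * x + th) * normal_pdf 0 s x) =
    - (s ^+ 2 * t) * G t.
  have h : \int[mu]_x ((- t * sin (t * x + th) - cos (t * x + th) * ((x - 0) / s ^+ 2))
      * normal_pdf 0 s x) = 0.
    apply: (@normal_stein _ 0 s s0 _ (fun x => - t * sin (t * x + th)) (1 + `|t|)).
    - move=> x; apply: is_derive_eq.
      by rewrite /GRing.scale /=; ring.
    - by move=> x; apply: cvgM; [exact: cvg_cst|exact: csin].
    - move=> x; rewrite (le_trans (cos_max _))// mulrDr mulr1 -addrA lerDl.
      by rewrite addr_ge0// mulr_ge0// addr_ge0.
    - move=> x; rewrite normrM normrN.
      by rewrite (@le_trans _ _ (`|t| * 1))// ?ler_wpM2l ?sin_max// mulr1 lerDr.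
  have : \int[mu]_x (- t * f t x -
      (s ^+ 2)^-1 * (x * cos (t * x + th) * normal_pdf 0 s x)) = 0.
    rewrite -[RHS]h; apply: eq_Rintegral => x _; rewrite /f.
    by move: (sin _) (cos _) (normal_pdf _ _ _) => a b c; field.
  rewrite RintegralB//; last 2 first.
    exact: integrable_EFinZl.
    exact: integrable_EFinZl.
  rewrite !RintegralZl// => /eqP; rewrite subr_eq0 => /eqP e.
  by rewrite -[LHS](mulVKf s20) -e /G; ring.
have dG t : is_derive t (1 : R) G (- (s ^+ 2 * t) * G t).
  rewrite -G'E.
  (* Any neighbourhood of t would do: the dominating function |x| p(x) is uniform in the
     parameter. *)
  have t1 : [set` `]t - 1, t + 1[] t by rewrite /= in_itv/= ltrBlDr ltrDl ltr01.
  have ib : mu.-integrable setT (fun x : R => (`|x| * normal_pdf 0 s x)%:E).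
    apply: (@integrable_normal_pdfM _ 0 s s0 (fun x => `|x|) 1) => [|x].
      exact: measurableT_comp.
    rewrite mul1r subr0 normr_id -[in leRHS](@real_normK _ x) ?num_real//.
    move: (normr_ge0 x); move: `|x| => y y0.
    by have := sqr_ge0 (1 - y); nra.
  have h := @cvg_differentiation_under_integral _ _ _ mu f _ measurableT
    t _ _ t1 (fun t _ => intf t) _ (fun x => `|x| * normal_pdf 0 s x) _ ib.
  have pfE u y : partial1of2 f u y = y * cos (u * y + th) * normal_pdf 0 s y.
    by rewrite /partial1of2 derive1E; exact: derive_val.
  have {h} h : h^-1 *: (G (h + t) - G t) @[h --> 0^'] -->
      \int[mu]_x (x * cos (t * x + th) * normal_pdf 0 s x).
    under [X in _ --> X]eq_Rintegral do rewrite -pfE.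
    apply: h.
    - by move=> u y _ _; have [] := pf u y.
    - by move=> y; rewrite mulr_ge0 ?normal_pdf_ge0.
    - move=> u y _ _; rewrite pfE 2!normrM (ger0_norm (normal_pdf_ge0 _ _ _)).
      rewrite ler_wpM2r ?normal_pdf_ge0//.
      by rewrite -[leRHS]mulr1 ler_wpM2l ?cos_max.
  apply: DeriveDef.
    apply/cvg_ex; eexists; under eq_fun do rewrite scaler1; exact: h.
  by rewrite -derive1E; apply/cvg_lim.
pose H t := G t * expR (s ^+ 2 / 2 * t ^+ 2).
have dH t : is_derive t (1 : R) H 0.
  have := dG t => dGt.
  apply: is_derive_eq; rewrite /GRing.scale /=.
  by field.
have e : H 1 = H 0 by exact: is_derive_0_is_cst.
have : G 1 * expR (s ^+ 2 / 2) = G 0.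
  by move: e; rewrite /H expr1n mulr1 expr0n mulr0 expR0 mulr1.
rewrite {2}/G; under eq_Rintegral do rewrite /f mul0r add0r.
rewrite RintegralZl//; last exact: integrable_normal_pdf.
rewrite Rintegral_normal_pdf mulr1 => <-.
rewrite -mulrA -expRD mulNr subrr expR0 mulr1.
by apply: eq_Rintegral => x _; rewrite /f mul1r.
Qed.

End normal_law.

Lemma Rintegral_dirac d (T : measurableType d) (R : realType) (a : T) (g : T -> R) :
  measurable_fun setT g -> \int[\d_a]_x g x = g a.
Proof.
move=> mg; rewrite /Rintegral integral_dirac//; last exact/measurable_EFinP.
by rewrite diracT mul1e.
Qed.

(** * Gaussian variables and jointly Gaussian families *)

Section gaussian_sine.
Context d (T : measurableType d) (R : realType) (P : probability T R).

(** [D] is arbitrary so that the point masses and the normal laws in [gaussian_rv] are treated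
    alike. *)
Lemma Rintegral_law (Y : T -> R) (D : {measure set (measurableTypeR R) -> \bar R})
    (g : R -> R) :
  measurable_fun setT Y ->
  (forall A : set R, measurable A -> P (Y @^-1` A) = D A) ->
  measurable_fun setT g -> P.-integrable setT (EFin \o (g \o Y)) ->
  D.-integrable setT (EFin \o g) /\ \int[P]_w g (Y w) = \int[D]_x g x.
Proof.
move=> mY YD mg intg.
pose Y' : T -> measurableTypeR R := Y; pose g' : measurableTypeR R -> R := g.
have mY' : measurable_fun setT Y' by [].
have mg' : measurable_fun setT (EFin \o g') by exact/measurable_EFinP.
have YD' (A : set (measurableTypeR R)) :
  measurable A -> A `<=` setT -> pushforward P Y' A = D A.
  by move=> mA _; exact: YD.
split; last first.
  congr fine; transitivity (\int[pushforward P Y']_x (g' x)%:E)%E.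
    by rewrite integral_pushforward.
  exact: eq_measure_integral.
have /integrableP[_ ig] :=
  @integrable_pushforward _ _ _ _ _ _ mY' P setT _ mg' intg measurableT.
apply/integrableP; split => //.
suff <- : (\int[pushforward P Y']_x `|(EFin \o g') x| =
  \int[D]_x `|(EFin \o g') x|)%E by [].
exact: eq_measure_integral.
Qed.

Lemma integrable_expectationE (Y : T -> R) : P.-integrable setT (EFin \o Y) ->
  'E_P[Y]%E = (\int[P]_w Y w)%:E.
Proof. by move=> iY; rewrite unlock /Rintegral fineK// integrable_fin_num. Qed.

Lemma integrable_expectation_sqr (Y : T -> R) (v : R) : measurable_fun setT Y ->
  'E_P[fun w => (Y w ^+ 2)%R]%E = v%:E ->
  P.-integrable setT (EFin \o (fun w => Y w ^+ 2)).
Proof.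
rewrite unlock => mY EY; apply/integrableP; split.
  by apply/measurable_EFinP; exact: measurable_funX.
under eq_integral do rewrite /= ger0_norm ?sqr_ge0//.
by rewrite EY ltry.
Qed.

(** |Y Z| <= Y^2 + Z^2. Taking one factor to be 1 also gives integrability of a single variable. *)
Lemma integrable_sqr_integrable (Y Z : T -> R) :
  measurable_fun setT Y -> measurable_fun setT Z ->
  P.-integrable setT (EFin \o (fun w => Y w ^+ 2)) ->
  P.-integrable setT (EFin \o (fun w => Z w ^+ 2)) ->
  P.-integrable setT (EFin \o (fun w => Y w * Z w)).
Proof.
move=> mY mZ iY iZ; have iYZ := integrableD measurableT iY iZ.
apply: le_integrable iYZ => //.
  by apply/measurable_EFinP; exact: measurable_funM.
move=> w _; rewrite /= lee_fin (le_trans _ (ler_norm _))// normrM.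
rewrite -[Y w ^+ 2]real_normK ?num_real// -[Z w ^+ 2]real_normK ?num_real//.
have := sqr_ge0 (`|Y w| - `|Z w|).
by have := normr_ge0 (Y w); have := normr_ge0 (Z w); nra.
Qed.

(** The two moments identify the law: m = 0, and v is 0 for a point mass and s^2 for a normal
    law. *)
Lemma gaussian_rv_sin (Y : T -> R) (v th : R) : gaussian_rv P Y ->
  'E_P[Y]%E = 0%E -> 'E_P[fun w => (Y w ^+ 2)%R]%E = v%:E ->
  \int[P]_w sin (Y w + th) = sin th * expR (- v / 2).
Proof.
move=> [mY [m law]] EY EY2.
have iY2 := integrable_expectation_sqr mY EY2.
have i1 : P.-integrable setT (EFin \o (fun=> 1 ^+ 2 : R)).
  by apply: (@integrable_bounded _ _ _ _ _ 1) => // x; rewrite expr1n normr1.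
have iY : P.-integrable setT (EFin \o Y).
  rewrite (_ : Y = fun w => 1 * Y w); last by apply/funext => w; rewrite mul1r.
  exact: integrable_sqr_integrable.
have msin : measurable_fun setT (fun x : R => sin (x + th)).
  apply: measurableT_comp; last exact: measurable_funD.
  by apply: continuous_measurable_fun; exact: continuous_sin.
have isin : P.-integrable setT (EFin \o ((fun x => sin (x + th)) \o Y)).
  apply: (@integrable_bounded _ _ _ _ _ 1) => [|x]; last exact: sin_max.
  exact: measurableT_comp.
have msqr : measurable_fun setT (fun x : R => x ^+ 2).
  exact: measurable_funX.
move: EY EY2; rewrite !integrable_expectationE// => -[EY] [EY2].
case: law => [law|[s s0 law]].
  have dE (g : R -> R) : measurable_fun setT g ->
      P.-integrable setT (EFin \o (g \o Y)) -> \int[P]_w g (Y w) = g m.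
    move=> mg ig; have [_ ->] := @Rintegral_law Y (@dirac _ (measurableTypeR R) m R) _ mY law mg ig.
    exact: (@Rintegral_dirac _ (measurableTypeR R)).
  have := dE _ msin isin; have := dE _ msqr iY2.
  have := dE _ (@measurable_id _ _ _) iY.
  rewrite EY EY2 => <- -> ->.
  by rewrite add0r expr0n oppr0 mul0r expR0 mulr1.
have [j1 e1] := @Rintegral_law Y (normal_prob m s) _ mY law msin isin.
have [j2 e2] := @Rintegral_law Y (normal_prob m s) _ mY law (@measurable_id _ _ _) iY.
have [j3 e3] := @Rintegral_law Y (normal_prob m s) _ mY law msqr iY2.
move: e1 e2 e3; rewrite !(Rintegral_normal_prob s0)//.
rewrite Rintegral_normal_mean// EY => + m0; rewrite -m0 EY2.
move=> e1 e2; rewrite e1 {e1} (Rintegral_normal_sin th s0).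
suff -> : v = s ^+ 2 by [].
rewrite e2 -[RHS](Rintegral_normal_variance 0 s0).
by apply: eq_Rintegral => x _; rewrite subr0.
Qed.

Lemma Rintegral_sum (J : Type) (r : seq J) (f : J -> T -> R) :
  (forall j, P.-integrable setT (EFin \o f j)) ->
  P.-integrable setT (EFin \o (fun w => \sum_(j <- r) f j w)) /\
  \int[P]_w \sum_(j <- r) f j w = \sum_(j <- r) \int[P]_w f j w.
Proof.
move=> intf; elim: r => [|j r [ih1 ih2]].
  have -> : (fun w => \sum_(j <- [::]) f j w) = cst 0.
    by apply/funext => w; rewrite big_nil.
  rewrite big_nil; split; last by rewrite Rintegral_cst// mul0r.
  by apply: (@integrable_bounded _ _ _ _ _ 0) => // x; rewrite normr0.
have -> : (fun w => \sum_(j <- j :: r) f j w) =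
    fun w => f j w + \sum_(j <- r) f j w.
  by apply/funext => w; rewrite big_cons.
rewrite big_cons; split; first by have := integrableD measurableT (intf j) ih1.
by rewrite RintegralD// ih2.
Qed.

End gaussian_sine.

Section jointly_gaussian_sine.
Context d (T : measurableType d) (R : realType) (P : probability T R).
Variables (I : Type) (Y : I -> T -> R) (K : I -> I -> R).
Hypothesis gY : jointly_gaussian P Y.
Hypothesis EY : forall i, 'E_P[Y i]%E = 0%E.
Hypothesis EYY : forall i j, 'E_P[fun w => (Y i w * Y j w)%R]%E = (K i j)%:E.

(** Later sums run over pairs and disjoint unions, whereas [jointly_gaussian] speaks of indices in
    ['I_n]; the finite type is enumerated. *)
Lemma jointly_gaussian_sum (J : finType) (u : J -> I) (c : J -> R) :
  gaussian_rv P (fun w => \sum_j c j * Y (u j) w).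
Proof.
rewrite (_ : (fun w => _) = fun w => \sum_(k < #|J|)
    c (enum_val k) * Y (u (enum_val k)) w).
  exact: gY.
apply/funext => w; rewrite (reindex (@enum_val J J)) //.
by apply: onW_bij; exact: enum_val_bij.
Qed.

Lemma jointly_gaussian_measurable i : measurable_fun setT (Y i).
Proof.
have [+ _] := jointly_gaussian_sum (fun _ : unit => i) (fun=> 1).
by under eq_fun do rewrite big_const card_unit /= addr0 mul1r.
Qed.

Let iYY i j : P.-integrable setT (EFin \o (fun w => Y i w * Y j w)).
Proof.
have mY := jointly_gaussian_measurable.
apply: integrable_sqr_integrable => //.
  apply: (@integrable_expectation_sqr _ _ _ _ _ (K i i)) => //.
  by rewrite -EYY.
apply: (@integrable_expectation_sqr _ _ _ _ _ (K j j)) => //.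
by rewrite -EYY.
Qed.

Let iY i : P.-integrable setT (EFin \o Y i).
Proof.
rewrite (_ : Y i = fun w => 1 * Y i w); last by apply/funext => w; rewrite mul1r.
apply: integrable_sqr_integrable => //; [exact: jointly_gaussian_measurable| |exact: iYY].
by apply: (@integrable_bounded _ _ _ _ _ 1) => // x; rewrite expr1n normr1.
Qed.

Variables (J : finType) (u : J -> I) (c : J -> R).

Let L w := \sum_j c j * Y (u j) w.
Let V := \sum_j \sum_k c j * c k * K (u j) (u k).

Let EL2 : P.-integrable setT (EFin \o (fun w => L w ^+ 2)) /\
  \int[P]_w (L w ^+ 2) = V.
Proof.
have LE : (fun w => L w ^+ 2) =
    fun w => \sum_j \sum_k c j * c k * (Y (u j) w * Y (u k) w).
  apply/funext => w; rewrite expr2 /L big_distrl; apply: eq_bigr => j _.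
  by rewrite big_distrr; apply: eq_bigr => k _ /=; ring.
rewrite LE.
have h j k : P.-integrable setT (EFin \o (fun w => c j * c k * (Y (u j) w * Y (u k) w))).
  exact: integrable_EFinZl.
have h1 j := Rintegral_sum (index_enum J) (h j).
have [h2 e2] := Rintegral_sum (index_enum J) (fun j => (h1 j).1).
split => //; rewrite e2 /V; apply: eq_bigr => j _.
rewrite (h1 j).2; apply: eq_bigr => k _; rewrite RintegralZl//; congr (_ * _).
by apply/EFin_inj; rewrite -EYY integrable_expectationE.
Qed.

(** [V] is the second moment of [L]. Passed to the limit over second differences, this fixes the
    sign of rho''. *)
Lemma jointly_gaussian_covariance_ge0 : 0 <= V.
Proof. by rewrite -EL2.2 Rintegral_ge0// => w _; exact: sqr_ge0. Qed.

Lemma jointly_gaussian_sin (th : R) :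
  \int[P]_w sin (L w + th) = sin th * expR (- V / 2).
Proof.
have h j : P.-integrable setT (EFin \o (fun w => c j * Y (u j) w)).
  exact: integrable_EFinZl.
have [iL eL] := Rintegral_sum (index_enum J) h.
apply: gaussian_rv_sin.
- exact: jointly_gaussian_sum.
- rewrite integrable_expectationE// eL big1// => j _.
  rewrite RintegralZl//.
  suff -> : \int[P]_w Y (u j) w = 0 by rewrite mulr0.
  by apply/EFin_inj; rewrite -integrable_expectationE// EY.
- by have [i2 e2] := EL2; rewrite integrable_expectationE// e2.
Qed.

End jointly_gaussian_sine.

(** * Sine transforms determine laws *)

Section sign_approximation.
Context {R : realType}.

(* The fixed points -1, 0, 1 of this odd cubic are those of the sign, and 1 and
   -1 attract ]0, 1] and [-1, 0[. *)
Definition sg_step (x : R) : R := (3 * x - x ^+ 3) / 2.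

Lemma sg_stepN (n : nat) (x : R) : iter n sg_step (- x) = - iter n sg_step x.
Proof. by elim: n => // n ih; rewrite !iterS ih /sg_step; field. Qed.

(** With f the step, f(y) - y = y (1 - y) (1 + y) / 2 and 1 - f(y) = (1 - y)^2 (2 + y) / 2. The gap
    to 1 is thus multiplied by (1 - y) (2 + y) / 2 <= 1 - y / 2 <= 1 - x / 2, whence the geometric
    rate. *)
Let sg_step_pos (x : R) (n : nat) : 0 < x <= 1 ->
  [/\ x <= iter n sg_step x, iter n sg_step x <= 1 &
      1 - iter n sg_step x <= (1 - x / 2) ^+ n].
Proof.
move=> /andP[x0 x1]; elim: n => [|n [h1 h2 h3]].
  by split; rewrite ?lexx// expr0 /=; lra.
rewrite iterS; move: (iter n sg_step x) h1 h2 h3 => y h1 h2 h3.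
rewrite /sg_step; split.
- have : 0 <= y * ((1 - y) * (1 + y)) by rewrite !mulr_ge0//; lra.
  suff -> : (3 * y - y ^+ 3) / 2 = y + y * ((1 - y) * (1 + y)) / 2 by lra.
  by field.
- have : 0 <= (1 - y) ^+ 2 * (2 + y) by rewrite mulr_ge0 ?sqr_ge0//; lra.
  suff -> : (3 * y - y ^+ 3) / 2 = 1 - (1 - y) ^+ 2 * (2 + y) / 2 by lra.
  by field.
- rewrite [leRHS]exprSr (@le_trans _ _ ((1 - y) * (1 - x / 2)))//; last first.
    by rewrite ler_wpM2r//; lra.
  have -> : 1 - (3 * y - y ^+ 3) / 2 = (1 - y) * ((1 - y) * (2 + y) / 2).
    by field.
  by rewrite ler_wpM2l//; nra.
Qed.

Lemma norm_sg_step_le1 (x : R) (n : nat) : `|x| <= 1 -> `|iter n sg_step x| <= 1.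
Proof.
have h (y : R) : 0 <= y -> `|y| <= 1 -> `|iter n sg_step y| <= 1.
  rewrite le_eqVlt => /predU1P[<- _|y0].
    suff -> : iter n sg_step 0 = 0 by rewrite normr0.
    by elim: n => // n ih; rewrite iterS ih /sg_step; field.
  rewrite gtr0_norm// => y1.
  have [|h1 h2 _] := @sg_step_pos y n; first by rewrite y0.
  by rewrite ger0_norm// (le_trans _ h1)// ltW.
have [x0|x0] := leP 0 x; first exact: h.
rewrite -normrN -[in X in _ -> X]normrN -sg_stepN; apply: h.
by rewrite oppr_ge0 ltW.
Qed.

Lemma cvg_sg_step (x : R) : `|x| <= 1 ->
  iter n sg_step x @[n --> \oo] --> Num.sg x.
Proof.
have h (y : R) : 0 < y -> `|y| <= 1 -> iter n sg_step y @[n --> \oo] --> (1 : R).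
  move=> y0; rewrite gtr0_norm// => y1.
  have b n : 1 - (1 - y / 2) ^+ n <= iter n sg_step y <= 1.
    have [|_ h2 h3] := @sg_step_pos y n; first by rewrite y0.
    by rewrite h2 andbT; lra.
  apply: (@squeeze_cvgr _ _ _ _ (fun n => 1 - (1 - y / 2) ^+ n) (cst 1)).
  - exact: nearW.
  - rewrite -[X in _ --> X](subr0 1); apply: cvgB; first exact: cvg_cst.
    by apply: cvg_expr; rewrite ger0_norm; lra.
  - exact: cvg_cst.
move=> x1; have [x0|x0] := ltP 0 x; first by rewrite gtr0_sg//; exact: h.
move: x0; rewrite le_eqVlt => /predU1P[->|x0].
  rewrite sgr0 (_ : (fun n => _) = cst 0); first exact: cvg_cst.
  by apply/funext; elim => // n ih; rewrite iterS ih /sg_step /=; field.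
rewrite ltr0_sg//; have : iter n sg_step (- x) @[n --> \oo] --> (1 : R).
  by apply: h; rewrite ?oppr_gt0// normrN.
move=> hN; rewrite (_ : (fun n => _) = fun n => - iter n sg_step (- x)).
  exact: cvgN.
by apply/funext => n; rewrite sg_stepN opprK.
Qed.

(** For large n the argument lies in ]-1, 1[, where the sine has the sign of its argument: the
    sequence is eventually constant. *)
Lemma cvg_sg_sin (z : R) :
  Num.sg (sin (z / n.+1%:R)) @[n --> \oo] --> Num.sg z.
Proof.
apply: cvg_near_cst.
have h (y : R) (n : nat) : 0 < y -> y <= n%:R -> Num.sg (sin (y / n.+1%:R)) = 1.
  move=> y0 yn; apply/gtr0_sg/sin_gt0_pi/andP; split; first by rewrite divr_gt0.
  rewrite (@lt_le_trans _ _ 1)//; last by rewrite (le_trans _ (pi_ge2 _))// ler1n.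
  by rewrite ltr_pdivrMr// mul1r (le_lt_trans yn)// ltr_nat.
near=> n.
have zn : `|z| <= n%:R by near: n; exact: nbhs_infty_ger.
have [z0|z0|z0] := ltrgt0P z.
- by rewrite h ?gtr0_sg// -(gtr0_norm z0).
- rewrite (ltr0_sg z0) -[z]opprK mulNr sinN sgrN h ?oppr_gt0//.
  by rewrite -(ltr0_norm z0).
- by rewrite z0 mul0r sin0 sgr0.
Unshelve. all: end_near. Qed.

End sign_approximation.

Section cramer_wold.
Context d (S : measurableType d) (R : realType).
Variables (mu nu : {finite_measure set S -> \bar R}).
Variables (I : finType) (e : I -> S -> R).
Hypothesis me : forall i, measurable_fun setT (e i).

Let wave (a : I -> R) (th : R) (x : S) := sin (\sum_i a i * e i x + th).

Let bounded_mfun (v : S -> R) :=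
  measurable_fun setT v /\ exists C, forall x, `|v x| <= C.

(* [balanced w]: the signed measures [w mu] and [w nu] have the same sine
   transform. *)
Let balanced (w : S -> R) := bounded_mfun w /\ forall a th,
  \int[mu]_x (w x * wave a th x) = \int[nu]_x (w x * wave a th x).

(** Functions with equal integrals under mu and nu are not stable under products; multipliers are,
    and also under sums and bounded pointwise limits. They therefore grow from waves to signs to
    indicators; an indicator is finally applied to the weight 1. *)
Let multiplier (v : S -> R) := bounded_mfun v /\
  forall w, balanced w -> balanced (fun x => v x * w x).

Let measurable_wave a th : measurable_fun setT (wave a th).
Proof.
apply: measurableT_comp; first by apply: continuous_measurable_fun; exact: continuous_sin.
apply: measurable_funD => //; apply: measurable_sum => i.
exact: measurable_funM.
Qed.

Let bounded_wave a th : bounded_mfun (wave a th).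
Proof. by split => //; exists 1 => x; exact: sin_max. Qed.

Let bounded_mfunM v w :
  bounded_mfun v -> bounded_mfun w -> bounded_mfun (fun x => v x * w x).
Proof.
move=> [mv [C vC]] [mw [D wD]]; split; first exact: measurable_funM.
by exists (C * D) => x; rewrite normrM ler_pM.
Qed.

Let bounded_mfunD v w :
  bounded_mfun v -> bounded_mfun w -> bounded_mfun (fun x => v x + w x).
Proof.
move=> [mv [C vC]] [mw [D wD]]; split; first exact: measurable_funD.
by exists (C + D) => x; rewrite (le_trans (ler_normD _ _))// lerD.
Qed.

Let bounded_mfun_cst k : bounded_mfun (fun=> k).
Proof. by split => //; exists `|k|. Qed.

Let integrable_bmfun (m : {finite_measure set S -> \bar R}) v :
  bounded_mfun v -> m.-integrable setT (EFin \o v).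
Proof. by move=> [mv [C vC]]; exact: integrable_bounded vC. Qed.

Let bRintegralZl (m : {finite_measure set S -> \bar R}) k v : bounded_mfun v ->
  \int[m]_x (k * v x) = k * \int[m]_x v x.
Proof. by move=> bv; rewrite RintegralZl//; exact: integrable_bmfun. Qed.

Let bRintegralD (m : {finite_measure set S -> \bar R}) v w :
  bounded_mfun v -> bounded_mfun w ->
  \int[m]_x (v x + w x) = \int[m]_x v x + \int[m]_x w x.
Proof. by move=> bv bw; rewrite RintegralD//; exact: integrable_bmfun. Qed.

Let balancedZ k w : balanced w -> balanced (fun x => k * w x).
Proof.
move=> [bw ew]; split; first exact: bounded_mfunM.
move=> a th.
under eq_Rintegral do rewrite -mulrA.
under [RHS]eq_Rintegral do rewrite -mulrA.
by rewrite !bRintegralZl ?ew//; exact: bounded_mfunM.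
Qed.

Let balancedD w w' : balanced w -> balanced w' -> balanced (fun x => w x + w' x).
Proof.
move=> [bw ew] [bw' ew']; split; first exact: bounded_mfunD.
move=> a th.
under eq_Rintegral do rewrite mulrDl.
under [RHS]eq_Rintegral do rewrite mulrDl.
by rewrite !bRintegralD ?ew ?ew'//; exact: bounded_mfunM.
Qed.

Let bounded_mfun_lim (v_ : nat -> S -> R) (v : S -> R) (C : R) :
  (forall n, measurable_fun setT (v_ n)) -> (forall n x, `|v_ n x| <= C) ->
  (forall x, v_ n x @[n --> \oo] --> v x) -> bounded_mfun v.
Proof.
move=> mv vC v_v; split.
  by apply: (measurable_fun_cvg mv) => x _; exact: v_v.
exists C => x; have h : `|v_ n x| @[n --> \oo] --> `|v x| by apply: cvg_norm.
rewrite -(cvg_lim _ h)//; apply: limr_le; first by apply/cvg_ex; eexists; exact: h.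
by apply: nearW => n; exact: vC.
Qed.

Let multiplier_lim (v_ : nat -> S -> R) (v : S -> R) (C : R) :
  (forall n, multiplier (v_ n)) -> (forall n x, `|v_ n x| <= C) ->
  (forall x, v_ n x @[n --> \oo] --> v x) -> multiplier v.
Proof.
move=> mlt vC v_v.
have bv : bounded_mfun v.
  by apply: (@bounded_mfun_lim v_ _ C) => // n; have [[]] := mlt n.
split => // w bw; have [bw0 ew] := bw; have [mw [D wD]] := bw0; split; first exact: bounded_mfunM.
move=> a th.
have h (m : {finite_measure set S -> \bar R}) :
    (\int[m]_x (v_ n x * w x * wave a th x)) @[n --> \oo] -->
    \int[m]_x (v x * w x * wave a th x).
  apply: (@cvg_Rintegral_ae_bounded _ _ _ _ _ _ (C * D * 1)).
  - move=> n; apply: measurable_funM => //; apply: measurable_funM => //.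
    by have [[]] := mlt n.
  - by apply: measurable_funM => //; apply: measurable_funM => //; have [] := bv.
  - move=> n x; rewrite !normrM ler_pM ?mulr_ge0//; last exact: sin_max.
    by rewrite ler_pM.
  - by apply: aeW => x; apply: cvgMl; apply: cvgMl; exact: v_v.
have := h mu; under eq_fun do rewrite ((mlt _).2 _ bw).2.
by move=> /cvg_unique; apply => //; exact: h.
Qed.

Let multiplierM v v' :
  multiplier v -> multiplier v' -> multiplier (fun x => v x * v' x).
Proof.
move=> [bv mv] [bv' mv']; split; first exact: bounded_mfunM.
move=> w bw; under eq_fun do rewrite -mulrA.
by apply: (mv (fun x => v' x * w x)); exact: mv'.
Qed.

Let multiplierD v v' :
  multiplier v -> multiplier v' -> multiplier (fun x => v x + v' x).
Proof.
move=> [bv mv] [bv' mv']; split; first exact: bounded_mfunD.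
move=> w bw; under eq_fun do rewrite mulrDl.
by apply: balancedD; [exact: mv|exact: mv'].
Qed.

Let multiplier_cst k : multiplier (fun=> k).
Proof. by split => // w bw; exact: balancedZ. Qed.

Let multiplierB v v' :
  multiplier v -> multiplier v' -> multiplier (fun x => v x - v' x).
Proof.
move=> mv mv'; under eq_fun do rewrite -mulN1r.
by apply: multiplierD => //; apply: multiplierM.
Qed.

(* sin p sin q = (cos (p - q) - cos (p + q)) / 2. *)
Let multiplier_wave a th : multiplier (wave a th).
Proof.
split => // w [bw ew]; split; first exact: bounded_mfunM.
move=> b ph.
(* The shift of the phase by pi / 2 writes a cosine as a wave. *)
pose w1 := wave (fun i => a i - b i) (th - ph + pi / 2).
pose w2 := wave (fun i => a i + b i) (th + ph + pi / 2).
have E x : wave a th x * w x * wave b ph x =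
    2^-1 * (w x * w1 x) + (- 2^-1) * (w x * w2 x).
  rewrite /w1 /w2 /wave !addrA !sinDpihalf.
  rewrite (_ : \sum_i (a i - b i) * e i x =
    \sum_i a i * e i x - \sum_i b i * e i x); last first.
    by rewrite -sumrB; apply: eq_bigr => i _; rewrite mulrBl.
  rewrite (_ : \sum_i (a i + b i) * e i x =
    \sum_i a i * e i x + \sum_i b i * e i x); last first.
    by rewrite -big_split; apply: eq_bigr => i _; rewrite mulrDl.
  move: (\sum_i a i * e i x) (\sum_i b i * e i x) => A B.
  rewrite (_ : A - B + th - ph = (A + th) - (B + ph)); last by ring.
  rewrite (_ : A + B + th + ph = (A + th) + (B + ph)); last by ring.
  by move: (A + th) (B + ph) => p q; rewrite cosB cosD; field.
under eq_Rintegral do rewrite E.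
under [RHS]eq_Rintegral do rewrite E.
have b1 : bounded_mfun (fun x => w x * w1 x).
  by apply: bounded_mfunM => //; exact: bounded_wave.
have b2 : bounded_mfun (fun x => w x * w2 x).
  by apply: bounded_mfunM => //; exact: bounded_wave.
rewrite !bRintegralD; do ?by apply: (@bounded_mfunM (fun=> _)).
by rewrite !bRintegralZl// !ew.
Qed.

(** The iterates of [sg_step] are polynomials in [v] and stay in [-1, 1]. *)
Let multiplier_sg v : multiplier v -> (forall x, `|v x| <= 1) ->
  multiplier (fun x => Num.sg (v x)).
Proof.
move=> mv v1.
apply: (@multiplier_lim (fun n x => iter n sg_step (v x)) _ 1).
- elim=> //= n ih; rewrite /sg_step.
  apply: multiplierM => //; apply: multiplierB; first exact: multiplierM.
  by under eq_fun do rewrite exprS expr2; do ?apply: multiplierM.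
- by move=> n x; exact: norm_sg_step_le1.
- by move=> x; exact: cvg_sg_step.
Qed.

Let multiplier_sg_coord i c : multiplier (fun x => Num.sg (e i x - c)).
Proof.
apply: (@multiplier_lim (fun n x => Num.sg (sin ((e i x - c) / n.+1%:R))) _ 1).
- move=> n; apply: multiplier_sg => [|x]; last exact: sin_max.
  rewrite (_ : (fun x => _) =
    wave (fun j => (j == i)%:R / n.+1%:R) (- c / n.+1%:R)) //.
  apply/funext => x; rewrite /wave (bigD1 i)//= eqxx big1 => [|j /negbTE ->].
    by congr sin; rewrite mulr1n; ring.
  by rewrite mulr0n !mul0r.
- by move=> n x; rewrite normr_sg; case: eqP => //=; rewrite ler01.
- by move=> x; exact: cvg_sg_sin.
Qed.

Let multiplier_set (A : set S) := measurable A /\ multiplier \1_A.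

(** Complements come from 1 - 1_A. For a countable union, the products of the first n functions 1 -
    1_(A i) are bounded and tend to the indicator of the complement. *)
Let multiplier_sigma_algebra : sigma_algebra setT multiplier_set.
Proof.
split.
- by split => //; rewrite indic0; exact: multiplier_cst.
- move=> A [mA vA]; split; first exact: measurableD.
  rewrite (_ : \1_(_) = fun x => 1 - \1_A x); first exact: multiplierB.
  apply/funext => x; rewrite setTD !indicE in_setC.
  by case: (_ \in _); rewrite ?subrr ?subr0.
- move=> A hA; split; first by apply: bigcup_measurable => n _; have [] := hA n.
  pose p n x := \prod_(i < n) (1 - \1_(A i) x) : R.
  have mp n : multiplier (p n).
    elim: n => [|n ih].
      rewrite (_ : p 0%N = fun=> 1); first exact: multiplier_cst.
      by apply/funext => x; rewrite /p big_ord0.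
    rewrite (_ : p n.+1 = fun x => p n x * (1 - \1_(A n) x)).
      by apply: multiplierM => //; apply: multiplierB; [|have [] := hA n].
    by apply/funext => x; rewrite /p big_ord_recr.
  have p1 n x : `|p n x| <= 1.
    rewrite /p normr_prod; apply: prodr_ile1 => i _; rewrite normr_ge0/= indicE.
    by case: (_ \in _); rewrite /= ?subrr ?subr0 ?normr0 ?normr1.
  have cp x : p n x @[n --> \oo] --> (1 - \1_(\bigcup_k A k) x : R).
    apply: cvg_near_cst; rewrite indicE; case: (boolP (x \in _)).
      rewrite inE => -[k _ Akx]; near=> n; rewrite /p subrr.
      have kn : (k < n)%N by near: n; exact: nbhs_infty_gt.
      by rewrite (bigD1 (Ordinal kn))//= indicE mem_set// subrr mul0r.
    rewrite notin_setE => nA; apply: nearW => n; rewrite subr0 /p big1// => i _.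
    rewrite indicE memNset ?subr0// => Aix; apply: nA.
    by exists i.
  have : multiplier (fun x => 1 - \1_(\bigcup_k A k) x).
    exact: multiplier_lim cp.
  move=> /(multiplierB (multiplier_cst 1)).
  by under eq_fun do rewrite subKr.
Unshelve. all: end_near. Qed.

Let multiplier_set_coord i (B : set R) : measurable B ->
  multiplier_set (e i @^-1` B).
Proof.
move=> mB.
pose G : set (set R) := [set B | multiplier_set (e i @^-1` B)].
have sG : sigma_algebra setT G.
  have [h0 hD hU] := multiplier_sigma_algebra; split.
  - by rewrite /G/= preimage_set0.
  - by move=> A hA; rewrite /G/= setTD preimage_setC -setTD; exact: hD.
  - by move=> A hA; rewrite /G/= preimage_bigcup; exact: hU.
have hG : @RGenOInfty.G R `<=` G.
  move=> _ [c ->]; split.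
    rewrite -[X in measurable X]setTI.
    by apply: me => //; exact: measurable_itv.
  have hs := multiplier_sg_coord i c.
  (* (s^2 + s) / 2 is 1 at s = 1 and 0 at s = 0 and s = -1. *)
  rewrite (_ : \1_ _ = fun x => 2^-1 *
    (Num.sg (e i x - c) * Num.sg (e i x - c) + Num.sg (e i x - c))).
    by apply: multiplierM => //; apply: multiplierD => //; exact: multiplierM.
  apply/funext => x; rewrite indicE.
  have -> : (x \in e i @^-1` `]c, +oo[) = (c < e i x).
    by apply/idP/idP; rewrite inE/= in_itv/= andbT.
  have [h|h|->] := ltrgtP (e i x) c.
  - by rewrite ltr0_sg ?subr_lt0// mulrNN mulr1 subrr mulr0.
  - by rewrite gtr0_sg ?subr_gt0// mulr1 -[1 + 1]/(2%:R) mulVf// pnatr_eq0.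
  - by rewrite subrr sgr0 mulr0 addr0 mulr0.
have : <<s @RGenOInfty.G R >> `<=` G by exact: smallest_sub.
apply.
suff : (@RGenOInfty.G R).-sigma.-measurable B by [].
by rewrite -RGenOInfty.measurableE.
Qed.

Lemma cramer_wold :
  (forall a th, \int[mu]_x sin (\sum_i a i * e i x + th) =
                \int[nu]_x sin (\sum_i a i * e i x + th)) ->
  forall A, <<s [set e i @^-1` B | i in setT & B in measurable] >> A ->
  mu A = nu A.
Proof.
move=> h A sA.
have [mA vA] : multiplier_set A.
  move: A sA; apply: smallest_sub; first exact: multiplier_sigma_algebra.
  by move=> _ [i _ [B mB <-]]; exact: multiplier_set_coord.
have b1 : balanced (fun=> 1).
  split => // a th.
  under eq_Rintegral do rewrite mul1r.
  by under [RHS]eq_Rintegral do rewrite mul1r; exact: h.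
(* At frequency 0 and phase pi / 2 the wave is the constant 1, so the balance of [\1_A] compares the
   masses of [A]. *)
have := (vA.2 _ b1).2 (fun=> 0) (pi / 2).
have E (m : {finite_measure set S -> \bar R}) :
    \int[m]_x (\1_A x * 1 * wave (fun=> 0) (pi / 2) x) = fine (m A).
  under eq_Rintegral => x _.
    rewrite /wave big1; last by move=> i _; rewrite mul0r.
    rewrite add0r sin_pihalf !mulr1; over.
  by rewrite /Rintegral integral_indic// setIT.
rewrite !E => eA.
by rewrite -[LHS]fineK ?eA ?fineK//; exact: fin_num_measure.
Qed.

End cramer_wold.

(** * Borel sets of matrices *)

Section borel_matrices.
Context {R : realType} {N : nat}.

Definition mx_entry (ij : 'I_N * 'I_N) (M : borel_mx R N) : R :=
  (M : 'M[R]_N) ij.1 ij.2.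

(** Rational centres and radii 1 / (n + 1) give a countable base of the topology. *)
Let box (q : 'M[rat]_N) (n : nat) : set 'M[R]_N :=
  [set M | forall i j, `|M i j - ratr (q i j)| < n.+1%:R^-1].

Let box_basis (U : set 'M[R]_N) (M : 'M[R]_N) : open U -> U M ->
  exists q n, box q n M /\ box q n `<=` U.
Proof.
move=> oU UM; have /nbhs_ballP[e /= e0 eU] := open_nbhs_nbhs (conj oU UM).
(* Half of [e], since two points of a box are compared through its centre. *)
have [n ne] : exists n : nat, n.+1%:R^-1 < e / 2.
  have e20 : 0 < e / 2 by rewrite divr_gt0.
  have [n _ /(_ n (leqnn n)) h] := near_infty_natSinv_lt (PosNum e20).
  by exists n.
have n0 : (0 : R) < n.+1%:R^-1 by rewrite invr_gt0.
have h (ij : 'I_N * 'I_N) : exists q : rat,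
    `|M ij.1 ij.2 - ratr q| < n.+1%:R^-1.
  have lt : M ij.1 ij.2 - n.+1%:R^-1 < M ij.1 ij.2 + n.+1%:R^-1.
    by rewrite ltrD2l (lt_trans _ n0)// oppr_lt0.
  have [q] := rat_in_itvoo lt; rewrite in_itv/= => /andP[q1 q2]; exists q.
  by rewrite ltr_distlC q1 q2.
have [q qM] := choice h.
exists (\matrix_(i, j) q (i, j)), n; split => [i j|M' hM'].
  by rewrite mxE; exact: (qM (i, j)).
apply: eU; split => // i j; rewrite /ball/=.
have := qM (i, j); have := hM' i j; rewrite mxE /= => h1 h2.
rewrite (_ : M i j - M' i j = (M i j - ratr (q (i, j))) - (M' i j - ratr (q (i, j)))); last by ring.
by rewrite (le_lt_trans (ler_normB _ _))// (lt_trans (ltrD h2 h1))// [ltRHS]splitr ltrD.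
Qed.

Let entry_preimages : set (set (borel_mx R N)) :=
  [set mx_entry ij @^-1` B | ij in setT & B in @measurable _ R].

(** An open set is a countable union of boxes, and a box is a finite intersection of preimages under
    entries. This extends the conclusion of [cramer_wold] to all Borel sets. *)
Lemma borel_mx_entries (A : set (borel_mx R N)) : measurable A ->
  <<s [set mx_entry ij @^-1` B | ij in setT & B in @measurable _ R] >> A.
Proof.
pose F := @measurable _ (g_sigma_algebraType entry_preimages).
change (measurable A -> F A).
have Fbox q n : F (box q n).
  rewrite (_ : box q n = \big[setI/setT]_(ij : 'I_N * 'I_N)
      mx_entry ij @^-1` [set x | `|x - ratr (q ij.1 ij.2)| < n.+1%:R^-1]).
    apply: bigsetI_measurable => ij _; apply: sub_sigma_algebra.
    exists ij => //; exists [set x | `|x - ratr (q ij.1 ij.2)| < n.+1%:R^-1] => //.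
    rewrite [X in measurable X](_ : _ = ball (ratr (q ij.1 ij.2) : R) (n.+1%:R^-1 : R)).
      exact: measurable_ball.
    by apply/seteqP; split => x /=; rewrite /ball/= distrC.
  rewrite -bigcap_seq; apply/seteqP; split => M /= h.
    by move=> ij _; exact: h.
  by move=> i j; apply: (h (i, j)); rewrite /= mem_index_enum.
apply: smallest_sub; first exact: sigma_algebra_measurable.
move=> U oU.
(* Runs through the codes of pairs (q, n); a box not contained in [U], or an invalid code,
   contributes the empty set. *)
pose B k : set (borel_mx R N) :=
  if unpickle k is Some (q, n) then
    if `[< box q n `<=` U >] then box q n else set0
  else set0.
rewrite (_ : U = \bigcup_k B k).
  apply: bigcup_measurable => k _; rewrite /B.
  case: unpickle => [[q n]|]; last exact: measurable0.
  by case: ifP => _; [exact: Fbox|exact: measurable0].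
apply/seteqP; split => M.
  move=> UM; have [q [n [h1 h2]]] := box_basis oU UM.
  exists (pickle (q, n)) => //; rewrite /B pickleK.
  by rewrite ifT//; exact/asboolP.
move=> [k _]; rewrite /B; case: unpickle => [[q n]|//].
by case: ifPn => // /asboolP; apply.
Qed.

Lemma measurable_mx_entry (ij : 'I_N * 'I_N) : measurable_fun setT (mx_entry ij).
Proof.
apply: (measurability _ (RGenOpens.measurableE R)) => //.
move=> _ [_ [a [b ->]] <-]; rewrite setTI.
apply: sub_sigma_algebra => /=.
apply: open_comp; last exact: interval_open.
by move=> M _; exact: coord_continuous.
Qed.

Lemma measurable_borel_mx d (T : measurableType d) (f : T -> borel_mx R N) :
  (forall ij, measurable_fun setT (mx_entry ij \o f)) -> measurable_fun setT f.
Proof.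
move=> mf _ A mA; rewrite setTI.
have := borel_mx_entries mA; move: A {mA}.
apply: smallest_sub.
  split => [|A /= mA|A /= mA].
  - by rewrite /= preimage_set0.
  - by rewrite setTD preimage_setC; exact: measurableC.
  - by rewrite preimage_bigcup; exact: bigcup_measurable.
move=> _ [ij _ [B mB <-]]; rewrite /= -comp_preimage -[X in measurable X]setTI.
exact: mf.
Qed.

End borel_matrices.

(** * Covariance of the second differences *)

Section halfline_taylor.
Context {R : realType}.
Implicit Types (f : R -> R) (x l e : R).

(* A nonzero value of [deriv_halfline] is not the junk value of [lim]. *)
Lemma deriv_halfline_cvg f x : deriv_halfline f x != 0 ->
  (f y - f x) / (y - x) @[y --> within [set y | 0 <= y] (x^')]
    --> deriv_halfline f x.
Proof.
move=> fx; apply: contrapT => ndvg; move/eqP : fx; apply.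
apply: dvgP => cvgf; exact: ndvg.
Qed.

Lemma deriv_halfline0 f e : deriv_halfline f 0 != 0 -> 0 < e ->
  exists2 d : R, 0 < d & forall y : R, 0 < y < d ->
    `|(f y - f 0) / y - deriv_halfline f 0| <= e.
Proof.
move=> /deriv_halfline_cvg /cvgrPdist_le/[apply].
rewrite /within /= => -[d /= d0 h]; exists d => // y /andP[y0 yd].
have := h y; rewrite subr0 distrC; apply => //.
- by rewrite /ball/= sub0r normrN gtr0_norm.
- by rewrite gt_eqF.
- exact: ltW.
Qed.

(** Away from 0 the half-line is a neighbourhood: increments smaller than x never leave it. *)
Lemma is_derive_halfline f x : 0 < x -> deriv_halfline f x != 0 ->
  is_derive x (1 : R) f (deriv_halfline f x).
Proof.
move=> x0 /deriv_halfline_cvg fx.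
have h : h^-1 *: (f (h *: (1 : R) + x) - f x) @[h --> 0^'] --> deriv_halfline f x.
  apply/cvgrPdist_le => e e0.
  move/cvgrPdist_le : fx => /(_ _ e0); rewrite /within /= => -[d /= d0 h].
  exists (Num.min d x) => /=; first by rewrite lt_min d0.
  move=> y; rewrite /ball/= sub0r normrN lt_min => /andP[yd yx] yn0.
  have := h (y + x); rewrite /ball/= addrK opprD addrCA subrr addr0 normrN.
  rewrite /GRing.scale/= mulr1 [y^-1 * _]mulrC; apply => //.
  - by rewrite -subr_eq0 addrK.
  - by move: yx; rewrite ltr_norml => /andP[+ _]; rewrite ltrNl => ?; lra.
split; first by apply/cvg_ex; exists (deriv_halfline f x).
by rewrite /derive; apply/cvg_lim.
Qed.

(** This expansion with Peano remainder is all that the covariance limits use of the derivatives of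
    rho; it is one-sided because squared distances are nonnegative. *)
Definition taylor2 (rho : R -> R) (r1 r2 : R) : Prop := forall e, 0 < e ->
  exists2 d : R, 0 < d & forall u : R, 0 <= u < d ->
    `|rho u - (rho 0 + r1 * u + r2 / 2 * u ^+ 2)| <= e * u ^+ 2.

(** Differentiability of f near 0 is not given. It follows from f1 != 0: close to 0 the value of
    [deriv_halfline f] is near f1, hence nonzero, hence a true derivative. Then h(y) = f(y) - f1 y -
    f2 / 2 y^2 has |h'(y)| <= e y, and the mean value theorem bounds h(u) - h(0) by e u^2. *)
Lemma halfline_taylor2 f :
  let f1 := deriv_halfline f 0 in
  let f2 := deriv_halfline (deriv_halfline f) 0 in
  f1 != 0 -> f2 != 0 -> taylor2 f f1 f2.
Proof.
move=> f1 f2 f10 f20 e e0.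
have [d1 d10 h1] := deriv_halfline0 f10 ltr01.
have [d2 d20 h2] := deriv_halfline0 f20 e0.
rewrite -/f1 -/f2 in h1 h2.
pose K := `|f2| + e + 1.
have K0 : 0 < K by rewrite /K; have := normr_ge0 f2; lra.
(* The last bound excludes a zero derivative at y, which would give |f1| <= (|f2| + e) y < K y <
   |f1|. *)
pose d := Num.min d1 (Num.min d2 (`|f1| / K)).
have D (y : R) : 0 < y < d ->
    deriv_halfline f y != 0 /\ `|deriv_halfline f y - f1 - f2 * y| <= e * y.
  rewrite !lt_min => /and4P[y0 yd1 yd2 yd3].
  have b : `|deriv_halfline f y - f1 - f2 * y| <= e * y.
    have := h2 y; rewrite y0 yd2 => /(_ isT).
    rewrite (_ : deriv_halfline f y - f1 - f2 * y =
      ((deriv_halfline f y - f1) / y - f2) * y); last by field; rewrite gt_eqF.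
    by rewrite normrM (gtr0_norm y0) ler_pM2r.
  split => //; apply/eqP => D0; move: b.
  rewrite D0 sub0r -opprD normrN => b.
  have : `|f1| <= `|f1 + f2 * y| + `|f2 * y|.
    by rewrite -{1}[f1](addrK (f2 * y)) ler_normB.
  move: yd3; rewrite ltr_pdivlMr// normrM (gtr0_norm y0) /K => k1 k2.
  by nra.
exists d.
  by rewrite !lt_min d10 d20 divr_gt0// normr_gt0.
move=> u /andP[]; rewrite le_eqVlt => /predU1P[<- _|u0 ud].
  by rewrite !expr0n !mulr0 !addr0 subrr normr0.
pose h y := f y - f1 * y - f2 / 2 * y ^+ 2.
have dh (y : R) : 0 < y < d -> is_derive y (1 : R) h (deriv_halfline f y - f1 - f2 * y).
  move=> yd; have [Dn0 _] := D y yd; have /andP[y0 _] := yd.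
  have dfy := is_derive_halfline y0 Dn0.
  apply: is_derive_eq; rewrite /GRing.scale /=.
  by field.
have ch (y : R) : 0 < y < d -> {for y, continuous h}.
  move=> yd; apply/differentiable_continuous/derivable1_diffP.
  by have [] := dh y yd.
(* Right continuity at 0 comes from the bound |f1| + 1 on the difference quotient of f near 0. *)
have h0 : h x @[x --> 0^'+] --> h 0.
  apply/cvgrPdist_le => ep ep0.
  pose K' := `|f1| + 1 + `|f1| + `|f2|.
  have K'0 : 0 < K' by rewrite /K' ltr_wpDr// ltr_wpDr// ltr_wpDl.
  near=> x.
  have x0 : 0 < x by [].
  have x1 : x <= 1 by near: x; apply: nbhs_right_le.
  have xd1 : x < d1 by near: x; apply: nbhs_right_lt.
  have xe : x <= ep / K' by near: x; apply: nbhs_right_le; rewrite divr_gt0.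
  have := h1 x; rewrite x0 xd1 => /(_ isT) b.
  have b' : `|f x - f 0| <= (`|f1| + 1) * x.
    rewrite -ler_pdivrMr// -[X in _ / X](gtr0_norm x0) -normf_div.
    rewrite -[X in `|X|](subrK f1) (le_trans (ler_normD _ _))// addrC.
    by rewrite lerD2l.
  rewrite /h expr0n !mulr0 !subr0 distrC.
  rewrite (_ : _ - f 0 = (f x - f 0) - (f1 * x + f2 / 2 * x ^+ 2)); last by ring.
  rewrite (le_trans (ler_normB _ _))//.
  have b2 : `|f1 * x + f2 / 2 * x ^+ 2| <= (`|f1| + `|f2|) * x.
    rewrite (le_trans (ler_normD _ _))// mulrDl !normrM (gtr0_norm x0) lerD2l.
    by rewrite normfV normr_nat -mulrA ler_wpM2l//; nra.
  rewrite (le_trans (lerD b' b2))// -mulrDl !addrA.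
  by rewrite mulrC -ler_pdivlMr.
have hu : {within `[0, u], continuous h}.
  apply/(continuous_within_itvP _ u0); split => //.
  - move=> y; rewrite in_itv/= => /andP[y0 yu]; apply: ch.
    by rewrite y0 (lt_trans yu).
  - by apply: cvg_at_left_filter; apply: ch; rewrite u0.
have [|c] := @MVT _ h (fun y => deriv_halfline f y - f1 - f2 * y) 0 u u0 _ hu.
  move=> y; rewrite in_itv/= => /andP[y0 yu]; apply: dh.
  by rewrite y0 (lt_trans yu).
rewrite in_itv/= => /andP[c0 cu]; rewrite subr0 => E.
have [|_ Dc] := D c; first by rewrite c0 (lt_trans cu).
rewrite (_ : f u - _ = h u - h 0); last by rewrite /h; ring.
rewrite E normrM (gtr0_norm u0) expr2 mulrA ler_wpM2r ?(ltW u0)//.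
by rewrite (le_trans Dc)// ler_wpM2l// ?(ltW e0)// ltW.
Unshelve. all: end_near. Qed.

End halfline_taylor.

Section second_difference.
Context {R : realType} {N : nat}.
Implicit Types (f : 'rV[R]_N -> R) (t : 'rV[R]_N) (i j k l : 'I_N) (h : R).

Local Notation ev i := (delta_mx 0 i : 'rV[R]_N).

(** A mixed difference as a signed sum over corners has a covariance that is a signed sum of values
    of rho. For i = j it becomes the forward second difference with nodes 0, 1, 1, 2. *)
Definition corner i j (p : bool * bool) : 'rV[R]_N :=
  p.1%:R *: ev i + p.2%:R *: ev j.

Definition csgn (p : bool * bool) : R := (-1) ^+ (p.1 + p.2).

Definition second_difference f t i j h : R :=
  (\sum_p csgn p * f (t + h *: corner i j p)) / h ^+ 2.

Lemma sum_bool2 (F : bool * bool -> R) : \sum_p F p =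
  F (true, true) + F (true, false) + (F (false, true) + F (false, false)).
Proof.
transitivity (\sum_p F (p.1, p.2)); first by apply: eq_bigr => -[].
by rewrite -(pair_bigA _ (fun a b => F (a, b))) /= !big_bool.
Qed.

Lemma is_derive_line f (t v : 'rV[R]_N) (s : R) : derivable f (t + s *: v) v ->
  is_derive s (1 : R) (fun s => f (t + s *: v)) ('D_v f (t + s *: v)).
Proof.
have E : (fun h : R => h^-1 *: (f (t + (h *: (1 : R) + s) *: v) - f (t + s *: v))) =
    (fun h : R => h^-1 *: (f (h *: v + (t + s *: v)) - f (t + s *: v))).
  apply/funext => h; congr (_ *: (f _ - _)).
  have -> : h *: (1 : R) = h by exact: mulr1.
  by rewrite scalerDl addrCA.
by move=> df; split; [rewrite /derivable E|rewrite /derive E].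
Qed.

(** The mean value theorem twice: along e_j for the increment of f in direction e_i, then along e_i
    for the partial derivative in direction j. *)
Lemma second_difference_MVT f t i j h : C2 f -> 0 < h ->
  exists s r, [/\ 0 < s < h, 0 < r < h &
    second_difference f t i j h = partial i (partial j f) (t + s *: ev j + r *: ev i)].
Proof.
move=> [[cf df] d2f] h0.
have dj x : derivable f x (ev j) by have [] := df j.
have di x : derivable (partial j f) x (ev i) by have [_ /(_ i)[]] := d2f j.
pose g s := f (t + h *: ev i + s *: ev j) - f (t + s *: ev j).
have dg (s : R) : is_derive s (1 : R) g
    (partial j f (t + h *: ev i + s *: ev j) - partial j f (t + s *: ev j)).
  by apply: is_deriveB; apply: is_derive_line.
have cg : {within `[0, h], continuous g}.
  apply: continuous_subspaceT => s.
  by apply/differentiable_continuous/derivable1_diffP; have [] := dg s.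
have [s] := MVT h0 (fun s _ => dg s) cg.
rewrite in_itv/= subr0 => sh Eg.
pose k r := partial j f (t + s *: ev j + r *: ev i).
have dk (r : R) : is_derive r (1 : R) k (partial i (partial j f) (t + s *: ev j + r *: ev i)).
  exact: is_derive_line.
have ck : {within `[0, h], continuous k}.
  apply: continuous_subspaceT => r.
  by apply/differentiable_continuous/derivable1_diffP; have [] := dk r.
have [r] := MVT h0 (fun r _ => dk r) ck.
rewrite in_itv/= subr0 => rh Ek.
exists s, r; split => //.
have h2 : h ^+ 2 != 0 by rewrite expf_neq0// gt_eqF.
apply: (mulIf h2); rewrite /second_difference divfK//.
transitivity (g h - g 0).
  rewrite sum_bool2 /g /corner /csgn /=.
  rewrite !scale1r !scale0r !addr0 !add0r scaler0 addr0 !scalerDr addrA.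
  rewrite addn0 add0n -[(1 + 1)%N]/2%N expr0 expr1 sqrrN expr1n addrA.
  by move: (f _) (f _) (f _) (f _) => x1 x2 x3 x4; ring.
rewrite Eg expr2 mulrA; congr (_ * _); rewrite -Ek /k scale0r addr0.
by rewrite addrAC.
Qed.

Lemma cvg_second_difference f t i j : C2 f ->
  second_difference f t i j n.+1%:R^-1 @[n --> \oo] --> partial i (partial j f) t.
Proof.
move=> C2f; have cf : continuous (partial i (partial j f)).
  by have [_ /(_ j)[_ /(_ i)[]]] := C2f.
apply/cvgrPdist_lt => e e0.
have /cvgrPdist_lt/(_ _ e0)/nbhs_ballP[d /= d0 hd] := cf t.
near=> n.
have n0 : (0 : R) < n.+1%:R^-1 by rewrite invr_gt0.
have [s [r [/andP[s0 s1] /andP[r0 r1] ->]]] := second_difference_MVT t i j C2f n0.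
apply: hd; split => // a b; rewrite /ball/= !mxE.
rewrite -!addrA opprD addrA subrr add0r normrN.
have nd : n.+1%:R^-1 < d / 2.
  by near: n; apply: (near_infty_natSinv_lt (PosNum _)); rewrite divr_gt0.
have b1 (c : bool) (x : R) : 0 < x -> `|x * c%:R| <= x.
  by move=> x0; case: c; rewrite ?mulr1 ?mulr0 ?normr0 ?gtr0_norm// ltW.
rewrite (le_lt_trans (ler_normD _ _))//.
rewrite (le_lt_trans (lerD (b1 _ _ s0) (b1 _ _ r0)))//.
by rewrite (lt_trans (ltrD s1 r1))// [ltRHS]splitr ltrD.
Unshelve. all: end_near. Qed.

Lemma enorm2E (v : 'rV[R]_N) : enorm v ^+ 2 = \sum_m v 0 m ^+ 2.
Proof. by rewrite /enorm sqr_sqrtr// sumr_ge0// => m _; exact: sqr_ge0. Qed.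

Lemma enorm2Z h (v : 'rV[R]_N) : enorm (h *: v) ^+ 2 = h ^+ 2 * enorm v ^+ 2.
Proof.
by rewrite !enorm2E big_distrr; apply: eq_bigr => m _; rewrite mxE exprMn.
Qed.

Let sum_delta i j : \sum_m (m == i)%:R * (m == j)%:R = (i == j)%:R :> R.
Proof.
rewrite (bigD1 i)//= eqxx mul1r big1 ?addr0// => m /negbTE ->.
by rewrite mul0r.
Qed.

Lemma enorm2_comb4 i j k l (a b c d : R) :
  enorm (a *: ev i + b *: ev j - (c *: ev k + d *: ev l)) ^+ 2 =
  a ^+ 2 + b ^+ 2 + c ^+ 2 + d ^+ 2 + 2 * a * b * (i == j)%:R
  - 2 * a * c * (i == k)%:R - 2 * a * d * (i == l)%:R
  - 2 * b * c * (j == k)%:R - 2 * b * d * (j == l)%:R + 2 * c * d * (k == l)%:R.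
Proof.
pose S i j := \sum_m (m == i)%:R * (m == j)%:R : R.
transitivity (a ^+ 2 * S i i + b ^+ 2 * S j j + c ^+ 2 * S k k + d ^+ 2 * S l l
  + 2 * a * b * S i j + (- (2 * a * c)) * S i k + (- (2 * a * d)) * S i l
  + (- (2 * b * c)) * S j k + (- (2 * b * d)) * S j l + 2 * c * d * S k l).
  rewrite enorm2E /S !big_distrr -!big_split; apply: eq_bigr => m _ /=.
  by rewrite !mxE eqxx /=; ring.
have S1 n : S n n = 1 by rewrite /S sum_delta eqxx.
have S2 n1 n2 : S n1 n2 = (n1 == n2)%:R by exact: sum_delta.
by rewrite !S1 !S2; ring.
Qed.

Local Notation harm n := (n.+1%:R^-1 : R).

Let cvg_remainder (rho : R -> R) (r1 r2 q : R) : 0 <= q ->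
  taylor2 rho r1 r2 ->
  (rho (harm n ^+ 2 * q) - (rho 0 + r1 * (harm n ^+ 2 * q)
    + r2 / 2 * (harm n ^+ 2 * q) ^+ 2)) / harm n ^+ 4 @[n --> \oo] --> (0 : R).
Proof.
move=> q0 T; apply/cvgrPdist_le => e e0.
have q1 : 0 < q ^+ 2 + 1 by rewrite ltr_wpDl// sqr_ge0.
(* The remainder at h^2 q is at most this tolerance times q^2 h^4; adding 1 to q^2 covers q = 0. *)
have [|d d0 hd] := T (e / (q ^+ 2 + 1)); first by rewrite divr_gt0.
near=> n.
have h0 : 0 < harm n by rewrite invr_gt0.
have hn : harm n < Num.min 1 (d / (q + 1)).
  near: n; apply: (near_infty_natSinv_lt (PosNum _)).
  by rewrite lt_min ltr01/= divr_gt0// ltr_wpDl.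
move: hn; rewrite lt_min ltr_pdivlMr ?ltr_wpDl// => /andP[h1 h2].
have h4 : 0 < harm n ^+ 4 by rewrite exprn_gt0.
rewrite sub0r normrN normrM normfV (gtr0_norm h4) ler_pdivrMr//.
rewrite (le_trans (hd _ _))//.
  rewrite mulr_ge0 ?sqr_ge0//= (le_lt_trans _ h2)// expr2 -mulrA ler_wpM2l ?(ltW h0)//.
  by move: (harm n) h0 h1 => x x0 x1; nra.
rewrite exprMn -exprM mulrCA mulrC ler_wpM2r ?(ltW h4)//.
by rewrite mulrAC ler_pdivrMr// ler_wpM2l ?(ltW e0)// lerDl.
Unshelve. all: end_near. Qed.

Lemma cvgr_sum (J : finType) (u : J -> nat -> R) (l : J -> R) :
  (forall p, u p n @[n --> \oo] --> l p) ->
  \sum_p u p n @[n --> \oo] --> \sum_p l p.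
Proof. by move=> ul; apply: cvg_big => [|p _]; [exact: add_continuous|exact: ul]. Qed.

(** The zero sum of the weights removes rho 0 / h^4, and the first-order term, of size 1 / h^2, is
    subtracted. Multiplying by h^2 gives [cvg_covariance1]; a vanishing first-order sum gives
    [cvg_covariance2]. *)
Let cvg_remainder_sum (rho : R -> R) (r1 r2 : R) (J : finType) (s q : J -> R) :
  (forall p, 0 <= q p) ->
  taylor2 rho r1 r2 ->
  \sum_p s p = 0 ->
  \sum_p s p * rho (harm n ^+ 2 * q p) / harm n ^+ 4
    - r1 / harm n ^+ 2 * \sum_p s p * q p @[n --> \oo] -->
    r2 / 2 * \sum_p s p * q p ^+ 2.
Proof.
move=> q0 T s0.
have h : \sum_p s p * ((rho (harm n ^+ 2 * q p) - (rho 0 + r1 * (harm n ^+ 2 * q p)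
    + r2 / 2 * (harm n ^+ 2 * q p) ^+ 2)) / harm n ^+ 4)
    + r2 / 2 * \sum_p s p * q p ^+ 2 @[n --> \oo] -->
    0 + r2 / 2 * \sum_p s p * q p ^+ 2.
  apply: cvgD; last exact: cvg_cst.
  rewrite [X in _ --> X](_ : 0 = \sum_p s p * 0); last first.
    by rewrite big1// => p _; rewrite mulr0.
  apply: cvgr_sum => p; apply: cvgM; first exact: cvg_cst.
  exact: cvg_remainder.
rewrite add0r in h; apply: cvg_trans h; apply: near_eq_cvg; near=> n.
have hn0 : harm n != 0 by rewrite gt_eqF// invr_gt0.
have E p : s p * rho (harm n ^+ 2 * q p) / harm n ^+ 4 =
    s p * ((rho (harm n ^+ 2 * q p) - (rho 0 + r1 * (harm n ^+ 2 * q p)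
      + r2 / 2 * (harm n ^+ 2 * q p) ^+ 2)) / harm n ^+ 4)
    + r1 / harm n ^+ 2 * (s p * q p) + r2 / 2 * (s p * q p ^+ 2)
    + rho 0 / harm n ^+ 4 * s p.
  by move: (rho (harm n ^+ 2 * q p)) => x; field.
rewrite [in RHS](eq_bigr _ (fun p _ => E p)) !big_split /= -!big_distrr /= s0.
by ring.
Unshelve. all: end_near. Qed.

Lemma cvg_covariance1 (rho : R -> R) (r1 r2 : R) (J : finType) (s q : J -> R) :
  (forall p, 0 <= q p) ->
  taylor2 rho r1 r2 ->
  \sum_p s p = 0 ->
  (\sum_p s p * rho (harm n ^+ 2 * q p)) / harm n ^+ 2 @[n --> \oo] -->
    r1 * \sum_p s p * q p.
Proof.
move=> q0 T s0; have h := cvg_remainder_sum q0 T s0.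
have h2 : harm n ^+ 2 @[n --> \oo] --> (0 : R).
  have ch : harm n @[n --> \oo] --> (0 : R) by exact: cvg_harmonic.
  suff : harm n ^+ 2 @[n --> \oo] --> (0 * 0 : R) by rewrite mulr0.
  by apply: cvgM.
have hh : harm n ^+ 2 * (\sum_p s p * rho (harm n ^+ 2 * q p) / harm n ^+ 4
    - r1 / harm n ^+ 2 * \sum_p s p * q p) + r1 * \sum_p s p * q p
    @[n --> \oo] -->
    0 * (r2 / 2 * \sum_p s p * q p ^+ 2) + r1 * \sum_p s p * q p.
  by apply: cvgD; [exact: cvgM|exact: cvg_cst].
rewrite mul0r add0r in hh; apply: cvg_trans hh; apply: near_eq_cvg; near=> n.
have hn0 : harm n != 0 by rewrite gt_eqF// invr_gt0.
rewrite -mulr_suml /=.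
by move: (\sum_p _ * rho _) (\sum_p _ * q _) => x y; field.
Unshelve. all: end_near. Qed.

Lemma cvg_covariance2 (rho : R -> R) (r1 r2 : R) (J : finType) (s q : J -> R) :
  (forall p, 0 <= q p) ->
  taylor2 rho r1 r2 ->
  \sum_p s p = 0 -> \sum_p s p * q p = 0 ->
  (\sum_p s p * rho (harm n ^+ 2 * q p)) / harm n ^+ 4 @[n --> \oo] -->
    r2 / 2 * \sum_p s p * q p ^+ 2.
Proof.
move=> q0 T s0 sq0; have := cvg_remainder_sum q0 T s0; rewrite sq0.
by under eq_fun do rewrite mulr0 subr0 -mulr_suml.
Qed.

End second_difference.

Section difference_covariance.
Context {R : realType} {N : nat}.
Variables (rho : R -> R) (r1 r2 : R).
Hypothesis rho_taylor : taylor2 rho r1 r2.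
Variable t : 'rV[R]_N.

Local Notation harm n := (n.+1%:R^-1 : R).
Local Notation K x y := (rho (enorm (x - y) ^+ 2)).
Local Notation dl i j := ((i == j)%:R : R).

(** On bits, the alternating sum extracts the coefficient of the product p.1 p.2 in the squared
    distance, here twice the Kronecker delta. *)
Lemma cvg_cov_value_difference (i j : 'I_N) :
  (\sum_p csgn p * K t (t + harm n *: corner i j p)) / harm n ^+ 2
    @[n --> \oo] --> 2 * r1 * dl i j.
Proof.
pose q (p : bool * bool) : R := enorm (corner i j p) ^+ 2.
have qE p : q p = p.1%:R ^+ 2 + p.2%:R ^+ 2 + 2 * p.1%:R * p.2%:R * dl i j.
  have := @enorm2_comb4 R N i j i j p.1%:R p.2%:R 0 0.
  by rewrite !scale0r addr0 subr0 -/(corner i j p) -/(q p) => ->; ring.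
have q0 p : 0 <= q p by exact: sqr_ge0.
have s0 : \sum_p csgn p = 0 :> R.
  by rewrite sum_bool2 /csgn /=; ring.
have sq : \sum_p csgn p * q p = 2 * dl i j :> R.
  by rewrite sum_bool2 !qE /csgn /=; ring.
have := @cvg_covariance1 _ rho r1 r2 _ csgn q q0 rho_taylor s0.
rewrite sq (_ : r1 * _ = 2 * r1 * dl i j); last by ring.
apply: cvg_trans; apply: near_eq_cvg; apply: nearW => n.
congr (_ / _); apply: eq_bigr => p _; congr (_ * rho _).
by rewrite /q -enorm2Z !enorm2E; apply: eq_bigr => m _; rewrite !mxE; ring.
Qed.

(** The alternating sum over four bits a, b, c, d extracts the coefficient of a b c d. The squared
    distance has degree 2, so it contributes 0; its square contributes 8 times the three pairings of
    {i, j, k, l}, and 8 r2 / 2 = 4 r2. *)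
Lemma cvg_cov_difference (i j k l : 'I_N) :
  (\sum_p \sum_q csgn p * csgn q *
    K (t + harm n *: corner i j p) (t + harm n *: corner k l q)) / harm n ^+ 4
    @[n --> \oo] -->
  4 * r2 * (dl i j * dl k l + dl i k * dl j l + dl i l * dl j k).
Proof.
pose q (p : (bool * bool) * (bool * bool)) : R :=
  enorm (corner i j p.1 - corner k l p.2) ^+ 2.
pose s (p : (bool * bool) * (bool * bool)) : R := csgn p.1 * csgn p.2.
have q0 p : 0 <= q p by exact: sqr_ge0.
have sum4 (F : (bool * bool) * (bool * bool) -> R) :
    \sum_p F p = \sum_p \sum_q F (p, q).
  transitivity (\sum_p F (p.1, p.2)); first by apply: eq_bigr => -[].
  by rewrite -(pair_bigA _ (fun a b => F (a, b))).
pose F (x1 x2 x3 x4 x5 x6 a b c d : R) := a ^+ 2 + b ^+ 2 + c ^+ 2 + d ^+ 2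
  + 2 * a * b * x1 - 2 * a * c * x2 - 2 * a * d * x3 - 2 * b * c * x4
  - 2 * b * d * x5 + 2 * c * d * x6.
have qE a b c d : q ((a, b), (c, d)) =
    F (dl i j) (dl i k) (dl i l) (dl j k) (dl j l) (dl k l) a%:R b%:R c%:R d%:R.
  exact: enorm2_comb4.
have s11 : csgn (true, true) = 1 :> R by rewrite /csgn /= sqrrN expr1n.
have s10 : csgn (true, false) = -1 :> R by rewrite /csgn /= expr1.
have s01 : csgn (false, true) = -1 :> R by rewrite /csgn /= expr1.
have s00 : csgn (false, false) = 1 :> R by rewrite /csgn /= expr0.
have sumE (f : R -> R) : \sum_p s p * f (q p) =
  let G a b c d := f (F (dl i j) (dl i k) (dl i l) (dl j k) (dl j l) (dl k l) a b c d) in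
  G 1 1 1 1 - G 1 1 1 0 - G 1 1 0 1 + G 1 1 0 0
  - G 1 0 1 1 + G 1 0 1 0 + G 1 0 0 1 - G 1 0 0 0
  - G 0 1 1 1 + G 0 1 1 0 + G 0 1 0 1 - G 0 1 0 0
  + G 0 0 1 1 - G 0 0 1 0 - G 0 0 0 1 + G 0 0 0 0.
  rewrite sum4 sum_bool2 !sum_bool2 !qE /s /= !s11 !s10 !s01 !s00.
  by clearbody F; rewrite /= !mulr0n !mulr1n; ring.
have s0 : \sum_p s p = 0 :> R.
  transitivity (\sum_p s p * 1); first by apply: eq_bigr => p _; rewrite mulr1.
  by rewrite (sumE (fun=> 1)) /=; ring.
have sq0 : \sum_p s p * q p = 0 :> R.
  rewrite (sumE id) /= /F.
  by move: (dl i j) (dl i k) (dl i l) (dl j k) (dl j l) (dl k l)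
    => x1 x2 x3 x4 x5 x6; ring.
have sq2 : \sum_p s p * q p ^+ 2 =
    8 * (dl i j * dl k l + dl i k * dl j l + dl i l * dl j k).
  rewrite (sumE (fun x => x ^+ 2)) /= /F.
  by move: (dl i j) (dl i k) (dl i l) (dl j k) (dl j l) (dl k l)
    => x1 x2 x3 x4 x5 x6; ring.
have := @cvg_covariance2 _ rho r1 r2 _ s q q0 rho_taylor s0 sq0.
rewrite sq2.
rewrite (_ : r2 / 2 * _ = 4 * r2 * (dl i j * dl k l + dl i k * dl j l + dl i l * dl j k)); last by field.
apply: cvg_trans; apply: near_eq_cvg; apply: nearW => n.
congr (_ / _); rewrite sum4; apply: eq_bigr => p _; apply: eq_bigr => p' _.
rewrite /s /q -enorm2Z; congr (_ * rho (enorm _ ^+ 2)).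
by rewrite scalerBr opprD addrACA subrr add0r.
Qed.

Section probe.
Variables (a0 : R) (a : 'I_N * 'I_N -> R).

Local Notation node := (unit + ('I_N * 'I_N) * (bool * bool))%type.

(* The finite sum [probe_sum] over nodes is a0 X(t) plus the [a]-combination of
   the second differences at scale 1/(n+1). *)
Definition probe_point (n : nat) (j : node) : 'rV[R]_N :=
  if j is inr (ij, p) then t + harm n *: corner ij.1 ij.2 p else t.

Definition probe_weight (n : nat) (j : node) : R :=
  if j is inr (ij, p) then a ij * csgn p / harm n ^+ 2 else a0.

Let sum_node (F : node -> R) :
  \sum_j F j = F (inl tt) + \sum_ij \sum_p F (inr (ij, p)).
Proof.
rewrite big_sumType /= (big_pred1 tt); last by case.
congr (_ + _); transitivity (\sum_(p : ('I_N * 'I_N) * (bool * bool)) F (inr (p.1, p.2))).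
  by apply: eq_bigr => -[].
by rewrite -(pair_bigA _ (fun a b => F (inr (a, b)))).
Qed.

Lemma probe_sum (Y : 'rV[R]_N -> R) (n : nat) :
  \sum_j probe_weight n j * Y (probe_point n j) =
  a0 * Y t + \sum_ij a ij * second_difference Y t ij.1 ij.2 (harm n).
Proof.
rewrite sum_node /=; congr (_ + _); apply: eq_bigr => ij _.
rewrite /second_difference mulr_suml mulr_sumr; apply: eq_bigr => p _.
by rewrite -!mulrA; congr (_ * (_ * _)); rewrite mulrC.
Qed.

Let KC (x y : 'rV[R]_N) : K x y = K y x.
Proof.
by rewrite !enorm2E; congr rho; apply: eq_bigr => m _; rewrite !mxE -opprB sqrrN.
Qed.

(** The double sum splits into value-value, twice value-difference, and difference-difference
    blocks, the last with two factors 1 / h^2. *)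
Lemma cvg_probe_variance :
  \sum_j \sum_k probe_weight n j * probe_weight n k *
    K (probe_point n j) (probe_point n k) @[n --> \oo] -->
  a0 ^+ 2 * rho 0 + 2 * (a0 * \sum_ij a ij * (2 * r1 * dl ij.1 ij.2)) +
  \sum_ij \sum_kl a ij * a kl * (4 * r2 * (dl ij.1 ij.2 * dl kl.1 kl.2
    + dl ij.1 kl.1 * dl ij.2 kl.2 + dl ij.1 kl.2 * dl ij.2 kl.1)).
Proof.
have K0 : K t t = rho 0.
  by rewrite subrr enorm2E big1// => m _; rewrite mxE expr0n.
pose C1 n (ij : 'I_N * 'I_N) :=
  (\sum_p csgn p * K t (t + harm n *: corner ij.1 ij.2 p)) / harm n ^+ 2.
pose C2 n (ij kl : 'I_N * 'I_N) := (\sum_p \sum_q csgn p * csgn q *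
    K (t + harm n *: corner ij.1 ij.2 p) (t + harm n *: corner kl.1 kl.2 q)) / harm n ^+ 4.
have E n : \sum_j \sum_k probe_weight n j * probe_weight n k *
    K (probe_point n j) (probe_point n k) =
    a0 ^+ 2 * rho 0 + 2 * (a0 * \sum_ij a ij * C1 n ij) +
    \sum_ij \sum_kl a ij * a kl * C2 n ij kl.
  have E1 : \sum_ij \sum_p a0 * (a ij * csgn p / harm n ^+ 2) *
      K t (t + harm n *: corner ij.1 ij.2 p) = a0 * \sum_ij a ij * C1 n ij.
    rewrite big_distrr; apply: eq_bigr => ij _ /=.
    rewrite /C1 mulr_suml !mulr_sumr; apply: eq_bigr => p _.
    by move: (rho _) => x; rewrite -!mulrA [_ * x]mulrC !mulrA.
  have E2 : \sum_ij \sum_p (a ij * csgn p / harm n ^+ 2) * a0 *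
      K (t + harm n *: corner ij.1 ij.2 p) t = a0 * \sum_ij a ij * C1 n ij.
    rewrite -E1; apply: eq_bigr => ij _; apply: eq_bigr => p _.
    by rewrite KC; congr (_ * _); rewrite mulrC.
  rewrite sum_node sum_node /= K0 E1.
  under [X in _ + X]eq_bigr => ij _ do under eq_bigr => p _ do rewrite sum_node /=.
  under [X in _ + X]eq_bigr => ij _ do rewrite big_split /=.
  rewrite big_split /= E2 -expr2 mulr2n mulrDl !mul1r !addrA; congr (_ + _).
  apply: eq_bigr => ij _; rewrite exchange_big /=; apply: eq_bigr => kl _.
  rewrite /C2 mulr_suml mulr_sumr; apply: eq_bigr => p _.
  rewrite mulr_suml mulr_sumr; apply: eq_bigr => q _.
  move: (rho _) => x; move: (harm n) => y; rewrite (_ : y ^+ 4 = y ^+ 2 * y ^+ 2); last by ring.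
  by rewrite [(y ^+ 2 * y ^+ 2)^-1]invfM; move: (y ^+ 2)^-1 => z; ring.
under eq_fun do rewrite E.
apply: cvgD.
  apply: cvgD; first exact: cvg_cst.
  apply: cvgM; first exact: cvg_cst.
  apply: cvgM; first exact: cvg_cst.
  apply: cvgr_sum => ij; apply: cvgM; first exact: cvg_cst.
  exact: cvg_cov_value_difference.
apply: cvgr_sum => ij; apply: cvgr_sum => kl; apply: cvgM; first exact: cvg_cst.
exact: cvg_cov_difference.
Qed.

End probe.

End difference_covariance.

(** * Law of the Hessian *)

Section laws.
Context {R : realType} d (T : measurableType d) (P : probability T R).

Lemma Rintegral_distribution d' (S : measurableType d') (X : {RV P >-> S})
    (f : S -> R) (C : R) : measurable_fun setT f -> (forall x, `|f x| <= C) ->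
  \int[distribution P X]_x f x = \int[P]_w f (X w).
Proof.
move=> mf fC; rewrite /Rintegral integral_distribution//.
  exact/measurable_EFinP.
by apply: (@integrable_bounded _ _ _ _ _ C) => //; exact: measurableT_comp.
Qed.

Lemma Rintegral_prod d' (S : measurableType d') (Q : probability S R)
    (f : T * S -> R) (C : R) : measurable_fun setT f -> (forall z, `|f z| <= C) ->
  \int[(P \x Q)%E]_z f z = \int[P]_x \int[Q]_y f (x, y).
Proof.
move=> mf fC.
have intf : (P \x Q)%E.-integrable setT (EFin \o f).
  apply: measurable_bounded_integrable => //.
    have PQ1 : (P \x Q)%E [set: T * S] = 1%E by exact: probability_setT.
    by rewrite [ltLHS]PQ1 ltry.
  by exists C; split => [|M CM x _]; rewrite ?num_real//= (le_trans (fC x))// ltW.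
rewrite /Rintegral -(integral12_prod_meas1 intf); congr fine.
apply: eq_integral => x _; rewrite /fubini_F fineK//.
apply: integrable_fin_num => //.
apply: (@integrable_bounded _ _ _ Q (fun y => f (x, y)) C) => //.
by apply: measurableT_comp mf _; exact: measurable_pair1.
Qed.

End laws.

(** * Probability kernels from jointly measurable maps *)

Section pushforward_kernel.
Context {R : realType} d (T : measurableType d) (P : probability T R).
Context d' (S : measurableType d').
Variable g : R -> T -> S.
Hypothesis mg : measurable_fun setT (fun z : R * T => g z.1 z.2).

Lemma measurable_section (x : R) : measurable_fun setT (g x).
Proof. exact: (measurableT_comp mg (measurable_pair1 x)). Qed.

Definition section_RV (x : R) : {RV P >-> S} :=
  mfun_Sub (mem_set (measurable_section x)).

Definition pushforward_kernel (x : R) : {measure set S -> \bar R} :=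
  distribution P (section_RV x).

Let measurable_pushforward_kernel (A : set S) : measurable A ->
  measurable_fun setT (pushforward_kernel ^~ A).
Proof.
move=> mA.
have mA' : measurable ((fun z : R * T => g z.1 z.2) @^-1` A).
  by rewrite -[X in measurable X]setTI; exact: mg.
have := measurable_fun_xsection P mA'; apply: eq_measurable_fun => x _ /=.
rewrite /distribution /pushforward; congr (P _).
by apply/seteqP; split => w /=; rewrite /xsection /= inE.
Qed.

HB.instance Definition _ := isKernel.Build _ _ _ _ R pushforward_kernel
  measurable_pushforward_kernel.

Let pushforward_kernel_setT (x : R) : pushforward_kernel x setT = 1%E.
Proof. exact: probability_setT. Qed.

HB.instance Definition _ := Kernel_isProbability.Build _ _ _ _ R
  pushforward_kernel pushforward_kernel_setT.

Definition pushforward_pkernel : R.-pker R ~> S := pushforward_kernel.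

Lemma pushforward_pkernelE x A : pushforward_pkernel x A = P (g x @^-1` A).
Proof. by []. Qed.

End pushforward_kernel.

Section continuous_measurable.
Context {R : realType} {N : nat}.

Lemma measurable_continuous_borel_mx (f : 'M[R]_N -> R) : continuous f ->
  measurable_fun setT (f : borel_mx R N -> R).
Proof.
move=> cf; apply: (measurability _ (RGenOpens.measurableE R)) => //.
move=> _ [_ [a [b ->]] <-]; rewrite setTI.
apply: sub_sigma_algebra => /=.
by apply: open_comp; [move=> M _; exact: cf|exact: interval_open].
Qed.

Lemma cvg_mx (u : nat -> 'M[R]_N) (M : 'M[R]_N) :
  (forall i j, u n i j @[n --> \oo] --> M i j) -> u n @[n --> \oo] --> M.
Proof.
move=> uM; apply/cvg_ballP => e e0.
have h (ij : 'I_N * 'I_N) : \forall n \near \oo, ball (M ij.1 ij.2) e (u n ij.1 ij.2).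
  by have /cvg_ballP := uM ij.1 ij.2; exact.
near=> n; split => // i j.
have hn : forall ij : 'I_N * 'I_N, ball (M ij.1 ij.2) e (u n ij.1 ij.2).
  by near: n; exact: filter_forall.
exact: (hn (i, j)).
Unshelve. all: end_near. Qed.

End continuous_measurable.

(** Variance of a0 X(t) + sum a_ij X_ij(t) when E X^2 = rho 0, E X X_ij = 2 r1 delta_ij, and E X_ij
    X_kl is 4 r2 times the sum over the three pairings. *)
Definition hessian_variance (R : realType) (N : nat) (rho : R -> R) (r1 r2 a0 : R)
    (a : 'I_N * 'I_N -> R) : R :=
  a0 ^+ 2 * rho 0 + 2 * (a0 * \sum_ij a ij * (2 * r1 * (ij.1 == ij.2)%:R)) +
  \sum_ij \sum_kl a ij * a kl * (4 * r2 * ((ij.1 == ij.2)%:R * (kl.1 == kl.2)%:R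
    + (ij.1 == kl.1)%:R * (ij.2 == kl.2)%:R + (ij.1 == kl.2)%:R * (ij.2 == kl.1)%:R)).

Section hessian_law.
Context {R : realType} {N : nat} d (T : measurableType d) (P : probability T R).
Variables (X : 'rV[R]_N -> {RV P >-> R}) (rho : R -> R) (r1 r2 : R).
Hypothesis X_gaussian : jointly_gaussian P (fun t w => X t w).
Hypothesis X_centered : forall t, ('E_P[X t] = 0)%E.
Hypothesis X_covariance : forall t s,
  ('E_P[fun w => (X t w * X s w)%R] = (rho (enorm (t - s) ^+ 2))%:E)%E.
Hypothesis rho_taylor : taylor2 rho r1 r2.
Hypothesis X_C2 : {ae P, forall w, C2 (X^~ w)}.
Variable t : 'rV[R]_N.

Local Notation harm n := (n.+1%:R^-1 : R).

Local Notation D n ij w :=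
  (second_difference (fun s => X s w) t ij.1 ij.2 (harm n)).

Let measurable_D n (ij : 'I_N * 'I_N) : measurable_fun setT (fun w => D n ij w).
Proof.
apply: measurable_funM => //; apply: measurable_sum => p.
exact: measurable_funM.
Qed.

(** The Hessian is arbitrary off the event of C2 paths; a measurable map is obtained from the second
    differences, which are measurable everywhere. *)
Lemma hessian_version : exists H : {RV P >-> borel_mx R N},
  {ae P, forall w, (hessian (X^~ w) t : borel_mx R N) = H w} /\
  {ae P, forall w, forall ij,
    D n ij w @[n --> \oo] --> mx_entry ij (H w)}.
Proof.
(* The upper limit is defined and measurable even where the differences diverge; [fine] gives a
   default value where it is infinite. *)
pose h (w : T) : borel_mx R N :=
  \matrix_(i, j) fine (limn_esup (fun n => (D n (i, j) w)%:E)).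
have mh : measurable_fun setT h.
  apply: measurable_borel_mx => -[i j].
  rewrite (_ : _ \o _ = fun w => fine (limn_esup (fun n => (D n (i, j) w)%:E))).
    apply: measurableT_comp => //; apply: measurable_fun_limn_esup => n.
    by apply/measurable_EFinP.
  by apply/funext => w; rewrite /mx_entry /= mxE.
have hE w : C2 (X^~ w) -> forall ij,
    D n ij w @[n --> \oo] --> mx_entry ij (h w) /\
    mx_entry ij (h w) = partial ij.1 (partial ij.2 (X^~ w)) t.
  move=> C2w [i j]; have cD := @cvg_second_difference _ _ _ t i j C2w.
  suff -> : mx_entry (i, j) (h w) = partial i (partial j (X^~ w)) t by [].
  have cD' : (D n (i, j) w)%:E @[n --> \oo] -->
      (partial i (partial j (X^~ w)) t)%:E.
    by apply: cvg_EFin; [exact: nearW|exact: cD].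
  by rewrite /mx_entry mxE /= (cvg_limn_einf_sup cD').
exists (mfun_Sub (mem_set mh)); split; apply: filterS X_C2 => w /hE hw.
  by apply/matrixP => i j; rewrite mxE -(hw (i, j)).2.
by move=> ij; have [] := hw ij.
Qed.

Local Notation V := (hessian_variance rho r1 r2).

Lemma field_hessian_variance_ge0 a0 (a : 'I_N * 'I_N -> R) : 0 <= V a0 a.
Proof.
have h := @cvg_probe_variance _ _ rho r1 r2 rho_taylor t a0 a; rewrite -/(V a0 a) in h.
rewrite -(cvg_lim _ h)//; apply: limr_ge.
  by apply/cvg_ex; eexists; exact: h.
apply: nearW => n.
have := @jointly_gaussian_covariance_ge0 _ _ _ _ _ _ _ X_gaussian X_covariance.
exact.
Qed.

(** The transforms of the probes have two limits: by bounded convergence, and by their closed form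
    together with the limit of the variances. *)
Lemma field_hessian_sin (H : {RV P >-> borel_mx R N}) a0 (a : 'I_N * 'I_N -> R) th :
  {ae P, forall w, forall ij, D n ij w @[n --> \oo] --> mx_entry ij (H w)} ->
  \int[P]_w sin (a0 * X t w + \sum_ij a ij * mx_entry ij (H w) + th) =
  sin th * expR (- V a0 a / 2).
Proof.
move=> DH.
pose L n w := a0 * X t w + \sum_ij a ij * D n ij w.
have mL n : measurable_fun setT (L n).
  apply: measurable_funD; first exact: measurable_funM.
  by apply: measurable_sum => ij; exact: measurable_funM.
have msin (f : T -> R) : measurable_fun setT f ->
    measurable_fun setT (fun w => sin (f w + th)).
  move=> mf; apply: measurableT_comp; last exact: measurable_funD.
  by apply: continuous_measurable_fun; exact: continuous_sin.
have h1 : \int[P]_w sin (L n w + th) @[n --> \oo] -->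
    \int[P]_w sin (a0 * X t w + \sum_ij a ij * mx_entry ij (H w) + th).
  apply: (@cvg_Rintegral_ae_bounded _ _ _ P _ _ 1).
  - by move=> n; exact: msin.
  - apply: msin; apply: measurable_funD; first exact: measurable_funM.
    apply: measurable_sum => ij; apply: measurable_funM => //.
    by apply: measurableT_comp; [exact: measurable_mx_entry|].
  - by move=> n w; exact: sin_max.
  - apply: filterS DH => w DHw; apply: continuous_cvg; first exact: continuous_sin.
    apply: cvgD; last exact: cvg_cst.
    apply: cvgD; first exact: cvg_cst.
    by apply: cvgr_sum => ij; apply: cvgM; [exact: cvg_cst|exact: DHw].
have LE n : \int[P]_w sin (L n w + th) = sin th * expR (- (\sum_j \sum_k
    probe_weight a0 a n j * probe_weight a0 a n k *
    rho (enorm (probe_point t n j - probe_point t n k) ^+ 2)) / 2).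
  rewrite -(@jointly_gaussian_sin _ _ _ _ _ _ _ X_gaussian X_centered X_covariance
    _ (probe_point t n) (probe_weight a0 a n) th).
  by apply: eq_Rintegral => w _; rewrite (probe_sum t a0 a (fun s => X s w) n).
have h2 : \int[P]_w sin (L n w + th) @[n --> \oo] --> sin th * expR (- V a0 a / 2).
  under eq_fun do rewrite LE.
  apply: cvgM; first exact: cvg_cst.
  apply: continuous_cvg; first exact: continuous_expR.
  apply: cvgM; last exact: cvg_cst.
  by apply: cvgN; exact: cvg_probe_variance.
by apply: cvg_unique h1 h2.
Qed.

End hessian_law.

Section goi.
Context {R : realType} {N : nat} d (T : measurableType d) (P : probability T R).

Definition goi_variance (c : R) (b : 'I_N * 'I_N -> R) : R :=
  \sum_ij \sum_kl b ij * b kl *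
    (2^-1 * ((ij.1 == kl.1)%:R * (ij.2 == kl.2)%:R
           + (ij.1 == kl.2)%:R * (ij.2 == kl.1)%:R)
     + c * (ij.1 == ij.2)%:R * (kl.1 == kl.2)%:R).

Lemma GOI_sin (c : R) (M : {RV P >-> borel_mx R N}) (b : 'I_N * 'I_N -> R) (th : R) :
  GOI c M -> \int[P]_w sin (\sum_ij b ij * mx_entry ij (M w) + th) =
  sin th * expR (- goi_variance c b / 2).
Proof.
move=> [_ gM EM EMM].
exact: (jointly_gaussian_sin gM (fun ij => EM ij.1 ij.2)
  (fun ij kl => EMM ij.1 ij.2 kl.1 kl.2) id b th).
Qed.

End goi.

(** Gaussian regression as a completed square: a0 + 2 r1 tr is the total coefficient of X(t), and
    the GOI term is the conditional variance. [k2] stands for kappa^2 in (ii) and for 0 in (i). *)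
Lemma hessian_goi_variance (R : realType) (N : nat) (rho : R -> R) (r1 r2 a0 c k2 : R)
    (a : 'I_N * 'I_N -> R) :
  c ^+ 2 = 8 * r2 -> rho 0 = 1 -> k2 * r2 = r1 ^+ 2 ->
  hessian_variance rho r1 r2 a0 a =
  (a0 + 2 * r1 * \sum_ij a ij * (ij.1 == ij.2)%:R) ^+ 2
  + goi_variance ((1 - k2) / 2) (fun ij => c * a ij).
Proof.
move=> c2 rho0 k2E; rewrite /hessian_variance /goi_variance rho0 mulr1.
set tr := \sum_ij a ij * (ij.1 == ij.2)%:R.
have -> : \sum_ij a ij * (2 * r1 * (ij.1 == ij.2)%:R) = 2 * r1 * tr.
  by rewrite /tr mulr_sumr; apply: eq_bigr => ij _; ring.
have tr2 : tr ^+ 2 = \sum_ij \sum_kl a ij * a kl *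
    ((ij.1 == ij.2)%:R * (kl.1 == kl.2)%:R).
  rewrite expr2 /tr mulr_suml; apply: eq_bigr => ij _.
  by rewrite mulr_sumr; apply: eq_bigr => kl _; ring.
rewrite (_ : (a0 + 2 * r1 * tr) ^+ 2 = a0 ^+ 2 + 2 * (a0 * (2 * r1 * tr))
  + 4 * (k2 * r2) * tr ^+ 2); last by rewrite k2E; ring.
rewrite -[RHS]addrA; congr (_ + _); rewrite tr2 mulr_sumr -big_split.
apply: eq_bigr => ij _ /=; rewrite mulr_sumr -big_split; apply: eq_bigr => kl _ /=.
rewrite (_ : c * a ij * (c * a kl) = c ^+ 2 * (a ij * a kl)); last by ring.
rewrite c2.
move: (_ == _)%:R (_ == _)%:R (_ == _)%:R (_ == _)%:R (_ == _)%:R (_ == _)%:R.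
by move=> x1 x2 x3 x4 x5 x6; field.
Qed.

(** * Comparison of the transforms for the two claims *)

Theorem lemma3p4 (R : realType) (N : nat) (N_ge1 : (1 <= N)%N)
    (d : measure_display) (T : measurableType d) (P : probability T R)
    (X : 'rV[R]_N -> {RV P >-> R}) (rho : R -> R)
    (X_gaussian : jointly_gaussian P (fun t w => X t w))
    (X_centered : forall t, ('E_P[X t] = 0)%E)
    (X_unit_variance : forall t, ('V_P[X t] = 1)%E)
    (X_covariance : forall t s,
      ('E_P[fun w => (X t w * X s w)%R] = (rho (enorm (t - s) ^+ 2))%:E)%E)
    (X_smooth : smooth_field P (fun t w => X t w))
    (rho1 rho2 kappa : R)
    (rho1E : rho1 = deriv_halfline rho 0)
    (rho2E : rho2 = deriv_halfline (deriv_halfline rho) 0)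
    (kappaE : kappa = - rho1 / Num.sqrt rho2)
    (rho12_neq0 : rho1 * rho2 != 0)
    (d1 : measure_display) (T1 : measurableType d1) (P1 : probability T1 R)
    (Mt : {RV P1 >-> borel_mx R N}) (Mt_GOI : GOI (1 / 2) Mt)
    (d2 : measure_display) (T2 : measurableType d2) (P2 : probability T2 R)
    (M : {RV P2 >-> borel_mx R N}) (M_GOI : GOI ((1 - kappa ^+ 2) / 2) M)
    (t : 'rV[R]_N) :
  let hessX : T -> borel_mx R N := fun w => hessian (fun s => X s w) t in
  same_law P P1 hessX
    (fun w => Num.sqrt (8 * rho2) *: (Mt w : 'M[R]_N)) /\
  exists2 k : R.-pker R ~> borel_mx R N,
    conditional_law hessX (X t) k &
    forall (x : R) (A : set (borel_mx R N)), measurable A ->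
      k x A = P2 ((fun w => Num.sqrt (8 * rho2) *:
        ((M w : 'M[R]_N) - (kappa * x / Num.sqrt 2)%:M)) @^-1` A).
Proof.
move=> hessX.
have rho1_neq0 : rho1 != 0 by apply: contraNneq rho12_neq0 => ->; rewrite mul0r.
have rho2_neq0 : rho2 != 0 by apply: contraNneq rho12_neq0 => ->; rewrite mulr0.
have X_C2 := X_smooth.1.
have rho_taylor : taylor2 rho rho1 rho2.
  by rewrite rho1E rho2E; apply: halfline_taylor2; rewrite -?rho1E -?rho2E.
have rho0 : rho 0 = 1.
  apply: EFin_inj; rewrite -(X_unit_variance t) /variance covariance.unlock X_centered.
  transitivity ('E_P[fun w => (X t w * X t w)%R])%E.
    by rewrite X_covariance subrr enorm2E big1// => m _; rewrite mxE expr0n.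
  by congr expectation; apply/funext => w; rewrite !fctE /= !subr0.
have i0 : 'I_N := Ordinal N_ge1.
(* Nonnegativity of the limiting variance at a0 = 0 and [a] the indicator of (i0, i0), where it is
   12 rho2. *)
have rho2_gt0 : 0 < rho2.
  rewrite lt_def rho2_neq0/=.
  have := @field_hessian_variance_ge0 _ _ _ _ _ X rho rho1 rho2 X_gaussian
    X_covariance rho_taylor t 0 (fun ij => (ij == (i0, i0))%:R).
  rewrite /hessian_variance expr0n/= !mul0r mulr0 !add0r.
  rewrite (bigD1 (i0, i0))//= [X in _ + X]big1; last first.
    move=> ij /negbTE ->; rewrite big1// => kl _; by rewrite !mul0r.
  rewrite addr0 (bigD1 (i0, i0))//= [X in _ + X]big1; last first.
    by move=> ij /negbTE ->; rewrite mulr0 mul0r.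
  rewrite !eqxx mulr1n => h; lra.
pose c := Num.sqrt (8 * rho2).
have c2 : c ^+ 2 = 8 * rho2 by rewrite sqr_sqrtr// mulr_ge0// ltW.
have sr0 : Num.sqrt rho2 != 0 by rewrite gt_eqF// sqrtr_gt0.
have k2E : kappa ^+ 2 * rho2 = rho1 ^+ 2.
  by rewrite kappaE exprMn exprVn sqr_sqrtr ?ltW// divfK ?gt_eqF// sqrrN.
have ckE : c * kappa / Num.sqrt 2 = - (2 * rho1).
  have s20 : Num.sqrt 2 != 0 :> R by rewrite gt_eqF// sqrtr_gt0.
  have cE : c = 2 * (Num.sqrt 2 * Num.sqrt rho2).
    rewrite /c (_ : 8 = 2 ^+ 2 * 2); last by ring.
    by rewrite -mulrA sqrtrM ?sqr_ge0// sqrtr_sqr ger0_norm// sqrtrM.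
  by rewrite cE kappaE; field; rewrite sr0 s20.
have [H [hessH DH]] := @hessian_version _ _ _ _ P X X_C2 t.
split.
  pose cMt (w : T1) : borel_mx R N := c *: (Mt w : 'M[R]_N).
  have cMtE ij w : mx_entry ij (cMt w) = c * mx_entry ij (Mt w).
    by rewrite /mx_entry mxE.
  have mcMt : measurable_fun setT cMt.
    apply: measurable_borel_mx => ij.
    rewrite (_ : _ \o _ = fun w => c * mx_entry ij (Mt w)).
      apply: measurable_funM => //.
      by apply: measurableT_comp; [exact: measurable_mx_entry|].
    by apply/funext => w; exact: cMtE.
  pose cMtRV : {RV P1 >-> borel_mx R N} := mfun_Sub (mem_set mcMt).
  exists H, cMtRV; split => //; first exact: aeW.
  move=> A mA; apply: (cramer_wold measurable_mx_entry) => [a th|].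
    have mwave : measurable_fun setT
        (fun M : borel_mx R N => sin (\sum_ij a ij * mx_entry ij M + th)).
      apply: measurableT_comp; first by apply: continuous_measurable_fun; exact: continuous_sin.
      apply: measurable_funD => //; apply: measurable_sum => ij.
      by apply: measurable_funM => //; exact: measurable_mx_entry.
    rewrite !(Rintegral_distribution _ mwave (fun M => sin_max _)).
    have := field_hessian_sin X_gaussian X_centered X_covariance rho_taylor 0 a th DH.
    under eq_Rintegral do rewrite mul0r add0r.
    move=> ->.
    have := GOI_sin (fun ij => c * a ij) th Mt_GOI.
    under [in X in X = _ -> _]eq_Rintegral => w _.
      under eq_bigr => ij _ do rewrite (mulrC c) -mulrA -cMtE.
      over.
    move=> ->; congr (_ * expR (- _ / 2)).
    (* With a0 = 0 the variance does not involve r1; setting r1 = 0 allows k2 = 0, and the GOI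
       parameter becomes 1 / 2. *)
    transitivity (hessian_variance rho 0 rho2 0 a).
      by rewrite /hessian_variance !mul0r.
    rewrite (@hessian_goi_variance _ _ _ _ _ _ c 0)// ?mul0r ?expr0n//=.
    by rewrite mulr0 !mul0r addr0 expr0n add0r subr0.
  exact: borel_mx_entries.
pose g (x : R) (w : T2) : borel_mx R N :=
  c *: ((M w : 'M[R]_N) - (kappa * x / Num.sqrt 2)%:M).
have gE ij x w : mx_entry ij (g x w) =
    c * mx_entry ij (M w) + 2 * rho1 * x * (ij.1 == ij.2)%:R.
  rewrite /mx_entry /g !mxE mulrBr; congr (_ + _).
  have cx : c * (kappa * x / Num.sqrt 2) = - (2 * rho1) * x.
    by rewrite -ckE; move: (Num.sqrt 2)^-1 => s; ring.
  by case: (_ == _); rewrite ?mulr1n ?mulr0n ?mulr1 ?mulr0 ?oppr0// cx mulNr opprK.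
have mg : measurable_fun setT (fun z : R * T2 => g z.1 z.2).
  apply: measurable_borel_mx => ij.
  rewrite (_ : _ \o _ = fun z : R * T2 =>
    c * mx_entry ij (M z.2) + 2 * rho1 * z.1 * (ij.1 == ij.2)%:R).
    apply: measurable_funD; apply: measurable_funM => //.
      apply: measurableT_comp; first exact: measurable_mx_entry.
      exact: measurableT_comp.
    exact: measurable_funM.
  by apply/funext => z; exact: gE.
exists (pushforward_pkernel P2 mg); last by move=> x A mA; rewrite pushforward_pkernelE.
split; last first.
  move=> f cf [C fC].
  have mf := measurable_continuous_borel_mx cf.
  under eq_fun do rewrite (Rintegral_distribution _ mf fC).
  (* Continuity in x is tested on sequences, to which bounded convergence applies. *)
  move=> x; apply/(@cvg_nbhsP _ R^o) => u ux.
  apply: (@cvg_Rintegral_ae_bounded _ _ _ P2 _ _ C) => //.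
  - by move=> n; apply: measurableT_comp; last exact: measurable_section mg _.
  - by apply: measurableT_comp; last exact: measurable_section mg _.
  - apply: aeW => w; apply: continuous_cvg; first exact: cf.
    apply: cvg_mx => i j.
    have e y : (g y w : 'M[R]_N) i j = c * mx_entry (i, j) (M w) + 2 * rho1 * y * (i == j)%:R.
      exact: (gE (i, j)).
    under eq_fun do rewrite e; rewrite e.
    apply: cvgD; first exact: cvg_cst.
    by apply: cvgM; [apply: cvgM; [exact: cvg_cst|]|exact: cvg_cst].
exists H => // B A mB mA.
have mXH : measurable_fun setT (fun w => (X t w, H w)).
  exact: measurable_fun_pair.
pose XH : {RV P >-> (R * borel_mx R N)%type} := mfun_Sub (mem_set mXH).
pose PZ := distribution P (X t).
have mG : measurable_fun setT (fun z : R * T2 => (z.1, g z.1 z.2)).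
  exact: measurable_fun_pair.
(* The product measure realizes Z, with the law of X(t), independent of [M]. *)
pose G : {RV (PZ \x P2)%E >-> (R * borel_mx R N)%type} := mfun_Sub (mem_set mG).
pose e (i : unit + 'I_N * 'I_N) (z : R * borel_mx R N) : R :=
  if i is inr ij then mx_entry ij z.2 else z.1.
have me i : measurable_fun setT (e i).
  case: i => [[]|ij]; first exact: measurable_fst.
  by apply: measurableT_comp; [exact: measurable_mx_entry|exact: measurable_snd].
have sumE (a : unit + 'I_N * 'I_N -> R) z : \sum_i a i * e i z =
    a (inl tt) * z.1 + \sum_ij a (inr ij) * mx_entry ij z.2.
  by rewrite big_sumType /= (big_pred1 tt)//; case.
have mwave a th : measurable_fun setT (fun z => sin (\sum_i a i * e i z + th)).
  apply: measurableT_comp; first by apply: continuous_measurable_fun; exact: continuous_sin.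
  apply: measurable_funD => //; apply: measurable_sum => i.
  exact: measurable_funM.
have wave a th : \int[distribution P XH]_z sin (\sum_i a i * e i z + th) =
    \int[distribution (PZ \x P2)%E G]_z sin (\sum_i a i * e i z + th).
  rewrite !(Rintegral_distribution _ (mwave a th) (fun=> sin_max _)).
  have mwaveG : measurable_fun setT (fun z => sin (\sum_i a i * e i (G z) + th)).
    by apply: (measurableT_comp (mwave a th)).
  rewrite [RHS](@Rintegral_prod _ _ _ PZ _ _ P2 _ 1 mwaveG (fun=> sin_max _)).
  under eq_Rintegral do rewrite sumE /=.
  rewrite (field_hessian_sin X_gaussian X_centered X_covariance rho_taylor (a (inl tt)) (a \o inr) th DH).
  set tr := \sum_ij a (inr ij) * (ij.1 == ij.2)%:R.
  set v := goi_variance ((1 - kappa ^+ 2) / 2) (fun ij => c * a (inr ij)).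
  (* For fixed x the shift of the matrix only changes the phase of the GOI transform; the remaining
     sine in x is then integrated against the law of X(t). *)
  have inner x : \int[P2]_w sin (\sum_i a i * e i (G (x, w)) + th) =
      expR (- v / 2) * sin ((a (inl tt) + 2 * rho1 * tr) * x + th).
    rewrite mulrC -(GOI_sin _ _ M_GOI); apply: eq_Rintegral => w _; congr sin.
    rewrite sumE /= addrA; congr (_ + _).
    under eq_bigr do rewrite gE mulrDr.
    rewrite big_split /= addrCA; congr (_ + _).
      by apply: eq_bigr => ij _; ring.
    rewrite [RHS]mulrDl /tr mulr_sumr mulr_suml; congr (_ + _).
    by apply: eq_bigr => ij _; ring.
  under [RHS]eq_Rintegral do rewrite inner.
  have msin : measurable_fun setT
      (fun x => sin ((a (inl tt) + 2 * rho1 * tr) * x + th)).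
    apply: measurableT_comp; first by apply: continuous_measurable_fun; exact: continuous_sin.
    by apply: measurable_funD => //; exact: measurable_funM.
  rewrite [RHS]RintegralZl//; last first.
    by apply: (@integrable_bounded _ _ _ _ _ 1) => // x; exact: sin_max.
  rewrite (@Rintegral_distribution _ _ _ _ _ _ (X t) _ 1 msin (fun=> sin_max _)).
  have := jointly_gaussian_sin X_gaussian X_centered X_covariance
    (fun _ : unit => t) (fun=> a (inl tt) + 2 * rho1 * tr) th.
  have sum1 (f : unit -> R) : \sum_i f i = f tt by rewrite (big_pred1 tt)//; case.
  rewrite !sum1.
  under eq_Rintegral do rewrite sum1.
  move=> ->.
  rewrite (@hessian_goi_variance _ _ _ _ _ _ c (kappa ^+ 2))//.
  rewrite mulrCA -expRD; congr (_ * expR _).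
  rewrite (_ : rho (enorm (t - t) ^+ 2) = 1); last first.
    by rewrite subrr enorm2E big1// => m _; rewrite mxE expr0n.
  by rewrite /= -/v -/tr; lra.
(* Once its entries are measurable for the generated sigma-algebra, so is [snd] as a matrix. *)
have rect : <<s [set e i @^-1` U | i in setT & U in @measurable _ R] >> (B `*` A).
  set G0 := (X in <<s X >>).
  pose F := @measurable _ (g_sigma_algebraType G0).
  change (F (B `*` A)).
  rewrite (_ : B `*` A = fst @^-1` B `&` snd @^-1` A)//.
  apply: measurableI.
    by apply: sub_sigma_algebra; exists (inl tt) => //; exists B.
  rewrite -[_ @^-1` A]setTI.
  apply: (@measurable_borel_mx _ _ _ (g_sigma_algebraType G0) snd) => // ij _ U mU.
  by rewrite setTI; apply: sub_sigma_algebra; exists (inr ij) => //; exists U.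
have cw := @cramer_wold _ _ _ (distribution P XH) (distribution (PZ \x P2)%E G) _ e me wave _ rect.
apply: etrans cw _.
(* The product measure integrates sections: empty for x outside [B], the event defining the kernel
   for x in [B]. *)
transitivity (\int[PZ]_x P2 (xsection (G @^-1` (B `*` A)) x))%E => //.
rewrite [RHS]integral_mkcond; apply: eq_integral => x _.
rewrite patchE; case: ifPn => [/set_mem Bx|/negP Bx].
  change (P2 (xsection (G @^-1` (B `*` A)) x) = P2 (g x @^-1` A)).
  congr (P2 _); apply/seteqP; split => w; rewrite /xsection /= inE.
    by case.
  by split.
rewrite (_ : xsection _ x = set0) ?measure0//; apply/seteqP; split => // w.
by rewrite /xsection /= inE => -[/mem_set].
Qed.
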